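(* Let $R$ be a valuation ring. Then the following conditions are equivalent: (1) $R$ is maximal; (2) each singly projective $R$-module is separable; (3) each flat content $R$-module is locally projective.
   Context: A valuation ring is a commutative ring $R$ (possibly with zero-divisors) whose set of ideals is totally ordered by inclusion. $R$ is maximal if every family of cosets $\{a_i+L_i\mid i\in I\}$ ($a_i\in R$, $L_i$ ideals of $R$, $I$ an arbitrary index set) with the finite intersection property has a non-empty intersection. A module is uniserial if its set of submodules is totally ordered by inclusion. An $R$-module $M$ is separable if any finite subset of $M$ is contained in a direct summand of $M$ which is a finite direct sum of uniserial submodules. $M$ is singly projective if, for any cyclic submodule $N$ of $M$, the inclusion map $N\to M$ factors through a free module. $M$ is locally projective if, for any finitely generated submodule $N$ of $M$, there exist a free module $F$ and homomorphisms $\phi:M\to F$ and $\pi:F\to M$ such that $\pi(\phi(x))=x$ for all $x\in N$. For $x\in M$, the content ideal $\mathrm{c}(x)$ is the intersection of all ideals $A$ of $R$ for which $x\in AM$; $M$ is a content module if $x\in\mathrm{c}(x)M$ for all $x\in M$; a flat content module is a module that is both flat and content. *)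

(* Defs.v *)
From HB Require Import structures.
From mathcomp Require Import all_boot all_order all_algebra.
From mathcomp Require Import boolp classical_sets functions cardinality.

Set Implicit Arguments.
Unset Strict Implicit.
Unset Printing Implicit Defensive.

Import GRing.Theory.
Local Open Scope ring_scope.

(* A submodule of M is an element of the library structure [submodClosed M];
   [submod N] is N seen as a module, with inclusion [val]. *)
Record submod (R : comNzRingType) (M : lmodType R) (N : submodClosed M) :=
  Submod { submod_val : M; submod_valP : submod_val \in N }.

Section SubmodInstances.
Variables (R : comNzRingType) (M : lmodType R) (N : submodClosed M).
HB.instance Definition _ := [isSub for @submod_val R M N].
HB.instance Definition _ := [Choice of submod N by <:].
HB.instance Definition _ := [SubChoice_isSubLmodule of submod N by <:].
End SubmodInstances.

(* The library's [idealr] only covers proper ideals. *)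
Definition ideal (R : comNzRingType) := submodClosed R^o.

Definition uniserial (R : comNzRingType) (M : lmodType R) : Prop :=
  forall N1 N2 : submodClosed M, {subset N1 <= N2} \/ {subset N2 <= N1}.

Definition valuation_ring (R : comNzRingType) : Prop :=
  forall A B : ideal R, {subset A <= B} \/ {subset B <= A}.

Definition coset (R : comNzRingType) (a : R) (A : ideal R) : set R :=
  [set r | r - a \in A].

Definition maximal_ring (R : comNzRingType) : Prop :=
  forall (I : Type) (a : I -> R) (L : I -> ideal R),
    (forall J : set I, finite_set J ->
       (\bigcap_(i in J) coset (a i) (L i) !=set0)%classic) ->
    (\bigcap_i coset (a i) (L i) !=set0)%classic.

Section Modules.
Variable R : comNzRingType.
Implicit Types M F A B T P : lmodType R.

Definition cyclic M (N : submodClosed M) : Prop :=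
  exists g : M, forall x, x \in N <-> exists r : R, x = r *: g.

Definition finitely_generated M (N : submodClosed M) : Prop :=
  exists (n : nat) (g : 'I_n -> M), forall x,
    x \in N <-> exists c : 'I_n -> R, x = \sum_i c i *: g i.

Definition linearly_independent M (X : set M) : Prop :=
  forall (s : seq M) (c : M -> R), uniq s -> (forall x, x \in s -> X x) ->
    \sum_(x <- s) c x *: x = 0 -> forall x, x \in s -> c x = 0.

Definition spanning M (X : set M) : Prop :=
  forall y : M, exists (s : seq M) (c : M -> R),
    (forall x, x \in s -> X x) /\ y = \sum_(x <- s) c x *: x.

Definition free_module F : Prop :=
  exists X : set F, linearly_independent X /\ spanning X.

Definition direct_summand M (N : submodClosed M) : Prop :=
  exists K : submodClosed M,
    (forall x, x \in N -> x \in K -> x = 0) /\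
    (forall x, exists y z, [/\ y \in N, z \in K & x = y + z]).

Definition internal_direct_sum M (N : submodClosed M) (n : nat)
    (U : 'I_n -> submodClosed M) : Prop :=
  (forall x, x \in N <->
     exists u : 'I_n -> M, (forall i, u i \in U i) /\ x = \sum_i u i) /\
  (forall u : 'I_n -> M, (forall i, u i \in U i) ->
     \sum_i u i = 0 -> forall i, u i = 0).

Definition separable M : Prop :=
  forall S : set M, finite_set S ->
    exists N : submodClosed M,
      [/\ forall x, S x -> x \in N,
          direct_summand N &
          exists (n : nat) (U : 'I_n -> submodClosed M),
            internal_direct_sum N U /\ forall i, uniserial (submod (U i))].

Definition singly_projective M : Prop :=
  forall N : submodClosed M, cyclic N ->
    exists (F : lmodType R) (f : {linear submod N -> F}) (g : {linear F -> M}),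
      free_module F /\ forall x : submod N, g (f x) = val x.

Definition locally_projective M : Prop :=
  forall N : submodClosed M, finitely_generated N ->
    exists (F : lmodType R) (phi : {linear M -> F}) (pi : {linear F -> M}),
      free_module F /\ forall x, x \in N -> pi (phi x) = x.

(* [in_mul A x] : x belongs to the submodule A M. *)
Definition in_mul M (A : {pred R}) (x : M) : Prop :=
  exists (n : nat) (a : 'I_n -> R) (m : 'I_n -> M),
    (forall i, a i \in A) /\ x = \sum_i a i *: m i.

Definition content M (x : M) : {pred R} :=
  [pred r | `[< forall A : ideal R, in_mul A x -> r \in A >]].

Definition content_module M : Prop :=
  forall x : M, in_mul (content x) x.

(* (T, t) is a tensor product of M and A over R. *)
Definition is_tensor_product M A T
    (t : {bilinear M -> A -> T}) : Prop :=
  forall P (b : {bilinear M -> A -> P}),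
    exists g : {linear T -> P},
      (forall m a, g (t m a) = b m a) /\
      (forall g' : {linear T -> P},
         (forall m a, g' (t m a) = b m a) -> g' =1 g).

(* M (x) - preserves injections; h is the map M (x) f : M (x) A -> M (x) B.
   Tensor products exist by [tensor_product_exists] below. *)
Definition flat M : Prop :=
  forall A B (f : {linear A -> B}), injective f ->
  forall (TA TB : lmodType R) (tA : {bilinear M -> A -> TA}) (tB : {bilinear M -> B -> TB}),
    is_tensor_product tA -> is_tensor_product tB ->
  forall h : {linear TA -> TB},
    (forall m a, h (tA m a) = tB m (f a)) -> injective h.

End Modules.

Section Tensor.
Local Open Scope quotient_scope.
Variables (R : comNzRingType) (M A : lmodType R).

(* M (x) A as the quotient of formal sums of pairs (m, a) by the relations
   that hold in the image of every bilinear map. *)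
Definition formal_eval (P : lmodType R) (b : {bilinear M -> A -> P})
  (s : seq (M * A)) : P := \sum_(x <- s) b x.1 x.2.

Definition tensor_rel (s t : seq (M * A)) : bool :=
  `[< forall (P : lmodType R) (b : {bilinear M -> A -> P}),
        formal_eval b s = formal_eval b t >].

Lemma tensor_rel_equiv : equiv_class_of tensor_rel.
Proof.
split=> [s|s t|t s u].
- by apply/asboolP.
- by apply/asboolP/asboolP => h P b; rewrite h.
- by move=> /asboolP h1 /asboolP h2; apply/asboolP => P b; rewrite h1 h2.
Qed.

Canonical tensor_equiv := EquivRelPack tensor_rel_equiv.

Definition tensor := {eq_quot tensor_equiv}.
HB.instance Definition _ := EqQuotient.on tensor.
HB.instance Definition _ := Choice.on tensor.

Definition tensor_eval (P : lmodType R) (b : {bilinear M -> A -> P})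
  (x : tensor) : P := formal_eval b (repr x).

Lemma tensor_evalE P b s : @tensor_eval P b (\pi_tensor s) = formal_eval b s.
Proof.
rewrite /tensor_eval; have := reprK (\pi_tensor s).
by move/eqmodP/asboolP; apply.
Qed.

Lemma tensorP (x y : tensor) :
  (forall (P : lmodType R) (b : {bilinear M -> A -> P}), tensor_eval b x = tensor_eval b y) ->
  x = y.
Proof. by move=> h; rewrite -[x]reprK -[y]reprK; apply/eqmodP/asboolP. Qed.

Definition tensor_zero : tensor := \pi_tensor [::].
Definition tensor_add (x y : tensor) : tensor := \pi_tensor (repr x ++ repr y).
Definition tensor_scale (r : R) (x : tensor) : tensor :=
  \pi_tensor [seq (r *: p.1, p.2) | p <- repr x].
Definition tensor_opp := tensor_scale (- 1).

Lemma eval0 P b : @tensor_eval P b tensor_zero = 0.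
Proof. by rewrite tensor_evalE /formal_eval big_nil. Qed.
Lemma evalD P b x y :
  @tensor_eval P b (tensor_add x y) = tensor_eval b x + tensor_eval b y.
Proof. by rewrite tensor_evalE /formal_eval big_cat. Qed.
Lemma evalZ P b r x :
  @tensor_eval P b (tensor_scale r x) = r *: tensor_eval b x.
Proof.
rewrite tensor_evalE /tensor_eval /formal_eval big_map scaler_sumr.
by apply: eq_bigr => p _ /=; rewrite linearZl_LR.
Qed.
Lemma evalN P b x : @tensor_eval P b (tensor_opp x) = - tensor_eval b x.
Proof. by rewrite evalZ scaleN1r. Qed.

Let evalE := (evalN, evalD, evalZ, eval0).

Lemma tensor_addA : associative tensor_add.
Proof. by move=> x y z; apply: tensorP => P b; rewrite !evalE addrA. Qed.
Lemma tensor_addC : commutative tensor_add.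
Proof. by move=> x y; apply: tensorP => P b; rewrite !evalE addrC. Qed.
Lemma tensor_add0 : left_id tensor_zero tensor_add.
Proof. by move=> x; apply: tensorP => P b; rewrite !evalE add0r. Qed.
Lemma tensor_addN : left_inverse tensor_zero tensor_opp tensor_add.
Proof. by move=> x; apply: tensorP => P b; rewrite !evalD evalN eval0 addNr. Qed.

HB.instance Definition _ := GRing.isZmodule.Build tensor
  tensor_addA tensor_addC tensor_add0 tensor_addN.

Lemma tensor_scaleA r1 r2 (x : tensor) :
  tensor_scale r1 (tensor_scale r2 x) = tensor_scale (r1 * r2) x.
Proof. by apply: tensorP => P b; rewrite !evalE scalerA. Qed.
Lemma tensor_scale1 : left_id 1 tensor_scale.
Proof. by move=> x; apply: tensorP => P b; rewrite !evalE scale1r. Qed.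
Lemma tensor_scaleDr : right_distributive tensor_scale +%R.
Proof.
move=> r x y; apply: tensorP => P b.
by rewrite /GRing.add /= !evalE scalerDr.
Qed.
Lemma tensor_scaleDl (x : tensor) :
  {morph tensor_scale^~ x : r1 r2 / r1 + r2}.
Proof.
move=> r1 r2; apply: tensorP => P b.
by rewrite [in RHS]/GRing.add /= !evalE scalerDl.
Qed.

HB.instance Definition _ := GRing.Zmodule_isLmodule.Build R tensor
  tensor_scaleA tensor_scale1 tensor_scaleDr tensor_scaleDl.

Definition pure_tensor (m : M) (a : A) : tensor := \pi_tensor [:: (m, a)].

Lemma eval_pure P b m a : @tensor_eval P b (pure_tensor m a) = b m a.
Proof. by rewrite tensor_evalE /formal_eval big_seq1. Qed.

Lemma pure_tensor_bilinear :
  bilinear_for *:%R *:%R (pure_tensor : M -> A -> tensor).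
Proof.
split=> [a|m] r x y; apply: tensorP => P b;
  rewrite [in RHS]/GRing.add /= evalD [in RHS]/GRing.scale /= evalZ !eval_pure.
- by rewrite linearPl.
- by rewrite linearPr.
Qed.

HB.instance Definition _ := bilinear_isBilinear.Build R M A tensor
  *:%R *:%R pure_tensor pure_tensor_bilinear.

Lemma tensor_eval_linear P b : linear (@tensor_eval P b).
Proof. by move=> r x y; rewrite [in LHS]/GRing.add /= evalD evalZ. Qed.

Lemma tensor_sumE (x : tensor) :
  x = \sum_(p <- repr x) pure_tensor p.1 p.2.
Proof.
rewrite -[LHS]reprK; elim: (repr x) => [|p s ih]; first by rewrite big_nil.
rewrite big_cons -ih; apply: tensorP => P b.
rewrite [in RHS]/GRing.add /= evalD eval_pure !tensor_evalE.
by rewrite /formal_eval big_cons.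
Qed.

Lemma tensor_product_exists :
  exists (T : lmodType R) (t : {bilinear M -> A -> T}), is_tensor_product t.
Proof.
exists tensor, pure_tensor => P b.
pose L := GRing.isLinear.Build _ _ _ _ _ (tensor_eval_linear b).
pose g : {linear tensor -> P} := HB.pack (tensor_eval b) L.
exists g; split=> [m a|g' hg' x]; first exact: eval_pure.
rewrite (tensor_sumE x) !linear_sum; apply: eq_bigr => p _.
exact: etrans (hg' _ _) (esym (eval_pure b _ _)).
Qed.

End Tensor.

(* Main.v *)
(* Over a valuation ring, M is singly projective iff each nonzero x \in M is q w
   with w of zero annihilator.

   (1) => (2): for w of zero annihilator, the elements z with s z \in R w for some
   regular s form a pure uniserial submodule U. When R is maximal U is linearly
   compact, so it is a direct summand: a submodule K that is maximal for the
   embedding of U in M / K to remain pure is a complement. Summands are split off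
   one element at a time.

   (2) => (3): if M is flat and content, x = a w with c(x) = R a, and w has zero
   annihilator because M is flat; so M is singly projective. In a decomposition
   given by separability the nonzero uniserial summands are free of rank one.

   (3) => (1): maximality reduces to solving consistent systems of congruences
   x = a mod r. Call (N, e) immediate if R e is free and pure in N and every y in N
   is q (e + p m) with p a nonunit. Then N is flat and content, so by (3) there is
   a linear form N -> R sending e to 1, and it maps a solution in N to a solution
   in R. If all r are regular, or become so after division by a fixed r0, the
   required N is generated inside E^2, for E the injective hull of R. Otherwise
   the submodule R + Z E of E works, where Z is the ideal of zero-divisors. *)
From HB Require Import structures.
Require Import Defs.
From mathcomp Require Import all_boot all_order all_algebra.
From mathcomp Require Import boolp classical_sets functions cardinality.
From mathcomp Require Import ring.

Set Implicit Arguments.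
Unset Strict Implicit.
Unset Printing Implicit Defensive.

Import Order.TTheory GRing.Theory Num.Theory.
Local Open Scope quotient_scope.
Local Open Scope classical_set_scope.
Local Open Scope ring_scope.

(** * Submodules and partial linear maps *)

Section Submodules.
Variables (R : comNzRingType) (M : lmodType R).

Definition issub (K : set M) : Prop :=
  K 0 /\ forall r x y, K x -> K y -> K (r *: x + y).

Section Closure.
Variables (K : set M) (hK : issub K).

Lemma issub0 : K 0. Proof. by case: hK. Qed.

Lemma issubD x y : K x -> K y -> K (x + y).
Proof. by move=> hx hy; rewrite -[x]scale1r; apply: hK.2. Qed.

Lemma issubZ r x : K x -> K (r *: x).
Proof. by move=> hx; rewrite -[r *: x]addr0; apply: hK.2 => //; apply: issub0. Qed.

Lemma issubN x : K x -> K (- x).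
Proof. by move=> hx; rewrite -scaleN1r; apply: issubZ. Qed.

Lemma issubB x y : K x -> K y -> K (x - y).
Proof. by move=> hx hy; apply: issubD => //; apply: issubN. Qed.

Lemma issub_sum (n : nat) (u : 'I_n -> M) : (forall i, K (u i)) -> K (\sum_i u i).
Proof. by move=> hu; apply: (big_ind K) => //; [apply: issub0|apply: issubD]. Qed.

Lemma issub_submodClosed : exists N : submodClosed M, forall x, x \in N <-> K x.
Proof.
pose p : {pred M} := fun x => `[< K x >].
have pP : GRing.submod_closed p.
  split; first by apply/asboolP/issub0.
  by move=> r x y /asboolP hx /asboolP hy; apply/asboolP; apply: hK.2.
pose N : submodClosed M := HB.pack p (GRing.isSubmodClosed.Build R M p pP).
by exists N => x; split=> [/asboolP|hx]; last apply/asboolP.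
Qed.

End Closure.

Lemma issub_mem (N : submodClosed M) : issub [set x | x \in N].
Proof. by split=> [|r x y /= hx hy]; [exact: rpred0|rewrite /= rpredD ?rpredZ]. Qed.

Lemma max_sub (Q K0 : set M) : issub K0 -> (K0 `<=` Q) ->
  exists K : set M, [/\ issub K, (K0 `<=` K), (K `<=` Q) &
    forall x, (forall r k, K k -> Q (k + r *: x)) -> K x].
Proof.
move=> sK0 K0Q.
(* The guard [K !=set0] admits the empty set, the union of the empty chain. It is not maximal, since
   [K0] is a larger member of [P]. *)
pose P : set (set M) :=
  [set K | K !=set0 -> [/\ issub K, K0 `<=` K & K `<=` Q]].
have [F FP Ftot|A [PA Amax]] := @Zorn_bigcup M P.
  move=> [x0 [X0 FX0 X0x0]].
  have [//|sX0 K0X0 X0Q] := FP _ FX0; first by exists x0.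
  have FP' X x : F X -> X x -> [/\ issub X, (K0 `<=` X) & (X `<=` Q)].
    by move=> FX Xx; apply: FP FX _; exists x.
  split.
  - split; first by exists X0 => //; apply: issub0.
    move=> r x y [X FX Xx] [Y FY Yy].
    case: (Ftot X Y FX FY) => XY.
      by exists Y => //; have [sY _ _] := FP' _ _ FY Yy; apply: sY.2 => //; apply: XY.
    by exists X => //; have [sX _ _] := FP' _ _ FX Xx; apply: sX.2 => //; apply: XY.
  - by move=> x hx; exists X0 => //; apply: K0X0.
  - by move=> x [X FX Xx]; have [_ _] := FP' _ _ FX Xx; apply.
have [x0 Ax0] : (A !=set0).
  apply: contrapT => A0; apply: (Amax K0); last by split.
  split; first by move=> x Ax; case: A0; exists x.
  by move=> h; case: A0; exists 0; apply: h; apply: issub0.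
have [|sA K0A AQ] := PA; first by exists x0.
exists A; split=> // x hx; apply: contrapT => nAx.
pose B : set M := [set y | exists k r, A k /\ y = k + r *: x].
have AB : (A `<=` B).
  by move=> k Ak; exists k, 0; rewrite scale0r addr0.
apply: (Amax B).
  split=> // BA; apply: nAx; apply: BA.
  by exists 0, 1; rewrite scale1r add0r; split => //; apply: issub0.
move=> _; split.
- split; first by apply: AB; apply: issub0.
  move=> r y z [k [a [Ak ->]]] [l [b [Al ->]]].
  exists (r *: k + l), (r * a + b); split; first exact: sA.2.
  by rewrite scalerDr scalerDl scalerA addrACA.
- by move=> y /K0A; apply: AB.
- by move=> y [k [r [Ak ->]]]; apply: hx.
Qed.

Lemma cyclic_submodule (v : M) :
  exists A : submodClosed M, forall x, x \in A <-> exists c, x = c *: v.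
Proof.
apply: (@issub_submodClosed [set x | exists c, x = c *: v]); split.
  by exists 0; rewrite scale0r.
by move=> r _ _ [a ->] [b ->]; exists (r * a + b); rewrite scalerDl scalerA.
Qed.

End Submodules.

Section Relations.
Variables (R : comNzRingType) (A B : lmodType R).

(** Two values at the same point differ by a value at 0, so the last hypothesis makes [G]
    functional. *)
Lemma linear_of_rel (G : A -> B -> Prop) :
  (forall a, exists b, G a b) ->
  (forall r a b a' b', G a b -> G a' b' -> G (r *: a + a') (r *: b + b')) ->
  (forall b, G 0 b -> b = 0) ->
  exists g : {linear A -> B}, forall a b, G a b <-> g a = b.
Proof.
move=> /choice[g hg] lin inj.
have uniqG a b b' : G a b -> G a b' -> b = b'.
  move=> h h'; apply/eqP; rewrite -subr_eq0; apply/eqP/inj.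
  by have := lin (-1) _ _ _ _ h' h; rewrite !scaleN1r addNr addrC.
have gl : linear g by move=> r x y; apply: uniqG (hg _) _; apply: lin.
pose g' : {linear A -> B} := HB.pack g (GRing.isLinear.Build R A B *:%R g gl).
by exists g' => a b; split=> [h|<-]; [apply: uniqG (hg a) h|apply: hg].
Qed.

End Relations.

(** * Injective modules and extension of partial maps *)

Section InjectiveModules.
Variables (R : comNzRingType).

Definition graph (A B : lmodType R) (G : set (A * B)%type) : Prop :=
  issub G /\ forall b, G (0, b) -> b = 0.

(* Baer's criterion, a partial linear map R -> E being given by its graph. *)
Definition injective_module (E : lmodType R) : Prop :=
  forall H : set (R^o * E)%type, graph H ->
    exists x : E, forall r e, H (r, e) -> e = r *: x.

Lemma graphB (A B : lmodType R) (G : set (A * B)%type) : graph G ->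
  forall a b b', G (a, b) -> G (a, b') -> b = b'.
Proof.
move=> [sG iG] a b b' h h'; apply/eqP; rewrite -subr_eq0; apply/eqP/iG.
by have : G (a - a, b - b') := issubB sG h h'; rewrite subrr.
Qed.

(** Take a maximal partial map extending [G]. For any [b], it induces a partial map on the ideal of
    those [r] with [r b] in its domain; Baer's criterion gives a value at [b] compatible with it. *)
Lemma injective_extension (B E : lmodType R) (G : set (B * E)%type) :
  injective_module E -> graph G ->
  exists g : {linear B -> E}, forall b e, G (b, e) -> g b = e.
Proof.
move=> baerE [sG iG].
have [|K [sK GK KQ Kmax]] := @max_sub R (B * E)%type [set p | p.1 = 0 -> p.2 = 0] G sG.
  by move=> [b e] h /= b0; apply: iG; rewrite -b0.
have tot b : exists e, K (b, e).
  have [|x hx] := baerE [set p | K (p.1 *: b, p.2)].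
    split; [split|].
    - by rewrite /= scale0r; apply: (issub0 sK).
    - move=> r [x1 x2] [y1 y2] /= hx hy.
      have : K (r *: (x1 *: b) + y1 *: b, r *: x2 + y2) := sK.2 r _ _ hx hy.
      by rewrite scalerA -scalerDl.
    - by move=> e /=; rewrite scale0r => /KQ; apply.
  exists x; apply: Kmax => r [k1 k2] hk /= /eqP; rewrite addr_eq0 => /eqP hr.
  suff /hx -> : K (- r *: b, k2) by rewrite scaleNr addNr.
  by rewrite scaleNr -hr.
have [||e /KQ|g hg] := @linear_of_rel R B E (fun b e => K (b, e)).
- exact: tot.
- by move=> r a b a' b' h h'; apply: (sK.2 r _ _ h h').
- by apply.
by exists g => b e /GK /hg.
Qed.

End InjectiveModules.

(** * Divisible groups and character modules *)

Definition divisible (D : zmodType) : Prop :=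
  forall (n : nat) (d : D), (0 < n)%N -> exists x : D, x *+ n = d.

(** The domain of a partial map from the integers is generated by its least positive element [n];
    dividing the value at [n] by [n] extends the map. *)
Lemma divisible_injective (D : zmodType) : divisible D ->
  injective_module (zmodule D : lmodType int).
Proof.
move=> divD H [sH iH].
have [exn|nH] := pselect (exists n, (0 < n)%N && `[< exists d, H (n%:Z, d) >]); last first.
  exists 0 => r d hrd; rewrite scaler0.
  suff r0 : r = 0 by apply: iH; rewrite -r0.
  apply: contrapT => /eqP rN0; case: nH; exists `|r|%N.
  rewrite absz_gt0 rN0; apply/asboolP.
  have [r_ge0|r_lt0] := lerP 0 r.
    by exists d; rewrite gez0_abs.
  by exists (- d); rewrite ltz0_abs //; have := issubN sH hrd.
case: (ex_minnP exn) => n /andP[n_gt0 /asboolP[d hnd]] nmin.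
have [x xn] := divD n d n_gt0.
exists x => r e hre.
have hmod : H ((r %% n)%Z, e - (r %/ n)%Z *: d).
  have := sH.2 (- (r %/ n)%Z) _ _ hnd hre; congr (H (_, _)).
    by rewrite /= {2}(divz_eq r n) scaleNr /GRing.scale /= addKr.
  by rewrite /= scaleNr addrC.
have mod_ge0 : (0 <= r %% n)%Z by rewrite modz_ge0 // -lt0n.
have mod_lt : (r %% n < n)%Z by rewrite ltz_pmod.
have mod0 : (r %% n)%Z = 0.
  apply: contrapT => /eqP modN0.
  suff : (n <= `|(r %% n)%Z|)%N by rewrite leqNgt -ltz_nat gez0_abs // mod_lt.
  apply: nmin; rewrite absz_gt0 modN0 gez0_abs //.
  by apply/asboolP; exists (e - (r %/ n)%Z *: d).
have /eqP : e - (r %/ n)%Z *: d = 0 by apply: iH; rewrite -mod0.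
rewrite subr_eq0 => /eqP ->.
by rewrite {2}(divz_eq r n) mod0 addr0 -scalerA -xn.
Qed.

Lemma quotient_map (Y : zmodType) (I : zmodClosed Y) :
  exists (Q : zmodType) (q : {additive Y -> Q}),
    (forall z, exists y, q y = z) /\ forall y, q y = 0 <-> y \in I.
Proof.
pose Q : zmodType := {ideal_quot I}.
pose q : {additive Y -> Q} := (\pi_({ideal_quot I}) : Y -> Q).
exists Q, q; split=> [z|y]; first by exists (repr z); rewrite /q /= reprK.
have := Quotient.idealrBE I y 0; rewrite subr0 => ->.
by rewrite -[0 in X in X <-> _](raddf0 q); split => /eqP.
Qed.

Section DivisibleHull.
Variable X : zmodType.

Let V := X -> rat.
Let delta (x : X) : V := fun y => (x == y)%:R.
Let comb (s : seq (int * X)) : V := \sum_(p <- s) (fun y => delta p.2 y *~ p.1).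

(** After regrouping by the distinct elements [y] occurring in [s], the coefficient of [y] is the
    coordinate of [comb s] at [y]. *)
Lemma integer_combination_eq0 (s : seq (int * X)) :
  comb s = 0 -> \sum_(p <- s) p.2 *~ p.1 = 0.
Proof.
move=> s0; pose U := undup [seq p.2 | p <- s].
have -> : \sum_(p <- s) p.2 *~ p.1 =
    \sum_(y <- U) y *~ (\sum_(p <- s) p.1 *+ (p.2 == y)).
  under [RHS]eq_bigr do rewrite mulrz_sumr.
  rewrite exchange_big /=; apply: eq_big_seq => p ps.
  have pU : p.2 \in U by rewrite mem_undup map_f.
  rewrite (bigD1_seq _ pU (undup_uniq _)) /= eqxx big1 ?addr0 // => y.
  by rewrite eq_sym => /negbTE ->.
apply: big1 => y _; suff -> : \sum_(p <- s) p.1 *+ (p.2 == y) = 0 by rewrite mulr0z.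
apply/eqP; rewrite -(intr_eq0 rat) rmorph_sum /=; apply/eqP.
have := congr1 (fun f => f y) s0; rewrite /comb fct_sumE => h; rewrite -[RHS]h.
apply: eq_bigr => p _; rewrite /delta; case: (p.2 == y) => /=.
  by rewrite mulr1n.
by rewrite mul0rz.
Qed.

(* The hull is the quotient of Q^X by the integer relations among elements of X. *)
Let relations : {pred V} :=
  [pred f | `[< exists s, f = comb s /\ \sum_(p <- s) p.2 *~ p.1 = 0 >]].

Let relations_closed : GRing.zmod_closed relations.
Proof.
split.
  by apply/asboolP; exists [::]; rewrite /comb !big_nil.
move=> _ _ /asboolP[s [-> s0]] /asboolP[t [-> t0]]; apply/asboolP.
exists (s ++ [seq (- p.1, p.2) | p <- t]).
rewrite /comb !big_cat !big_map /= s0; split.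
  congr (_ + _); rewrite -sumrN; apply: eq_bigr => p _.
  by apply/funext => y; rewrite mulrNz.
by under eq_bigr do rewrite mulrNz; rewrite sumrN t0 oppr0 addr0.
Qed.

HB.instance Definition _ := GRing.isZmodClosed.Build V relations relations_closed.

Lemma divisible_embedding : exists (D : zmodType) (i : {additive X -> D}),
  divisible D /\ injective i.
Proof.
have [D [q [qsurj q0]]] := quotient_map relations.
pose i0 (x : X) : D := q (delta x).
have iB : zmod_morphism i0.
  move=> x y; rewrite /i0; apply/eqP; rewrite -subr_eq0 -!raddfB; apply/eqP/q0/asboolP.
  exists [:: (1, x - y); (-1, x); (1, y)]; rewrite /comb !big_cons !big_nil; split.
    apply/funext => z; rewrite !fctE /= !mulr1z mulrN1z opprD opprK.
    by congr (_ + (_ + _)); apply/esym/addr0.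
  by rewrite /= mulrN1z !mulr1z addr0 addrA addrAC addrNK subrr.
pose i : {additive X -> D} := HB.pack i0 (GRing.isZmodMorphism.Build X D i0 iB).
exists D, i; split.
  move=> n d n_gt0; have [f <-] := qsurj d.
  exists (q (fun y => f y / n%:R)); rewrite -raddfMn; congr (q _).
  apply/funext => y; rewrite natmulfctE -[LHS]mulr_natr divfK //.
  by rewrite pnatr_eq0 -lt0n.
apply: raddf_inj => x /q0/asboolP[s [xs s0]].
(* Since [delta x = comb s], prepending [-x] gives a combination equal to 0, and the terms of [s]
   already sum to 0 in [X]. *)
have := @integer_combination_eq0 ((-1, x) :: s).
rewrite /comb !big_cons -/(comb s) -xs s0 mulrN1z addr0 => h.
apply/eqP; rewrite -oppr_eq0; apply/eqP/h.
by apply/funext => y; rewrite !fctE /= mulrN1z addNr.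
Qed.

End DivisibleHull.

Lemma additive_extension (X D : zmodType) (G : set (X * D)%type) : divisible D ->
  G (0, 0) -> (forall x y, G x -> G y -> G (x - y)) -> (forall d, G (0, d) -> d = 0) ->
  exists g : {additive X -> D}, forall x d, G (x, d) -> g x = d.
Proof.
move=> divD G0 GB iG.
have GN x : G x -> G (- x) by move=> hx; rewrite -sub0r; apply: GB.
have GD x y : G x -> G y -> G (x + y) by move=> hx hy; rewrite -[y]opprK; apply/GB/GN.
have GM n x d : G (x, d) -> G (x *+ n, d *+ n).
  by move=> hx; elim: n => [|n ih] //; rewrite !mulrS; apply: (GD (x, d) (x *+ n, d *+ n)).
have [|g hg] := @injective_extension int (zmodule X) (zmodule D) G (divisible_injective divD).
  split=> //; split=> // r [x d] [y e] hx hy.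
  apply: (GD (r *: (x : zmodule X), r *: (d : zmodule D)) (y, e)) => //.
  case: r => n; first exact: GM.
  exact: (GN (x *+ n.+1, d *+ n.+1) (GM _ _ _ hx)).
have gB : zmod_morphism (g : X -> D) by move=> x y; apply: (raddfB g).
pose g0 : X -> D := g.
pose g' : {additive X -> D} := HB.pack g0 (GRing.isZmodMorphism.Build X D g0 gB).
by exists g' => x d /hg.
Qed.

Section Dual.
Variables (R : comNzRingType) (N : lmodType R) (D : zmodType).

Definition dual_pred : {pred N -> D} :=
  [pred f | `[< forall x y, f (x - y) = f x - f y >]].

Lemma dual_pred_closed : GRing.zmod_closed dual_pred.
Proof.
split; first by apply/asboolP => x y; apply/esym/subr0.
move=> f g /asboolP hf /asboolP hg; apply/asboolP => x y.
by rewrite !fctE hf hg !opprD !opprK addrACA.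
Qed.

HB.instance Definition _ :=
  GRing.isZmodClosed.Build (N -> D) dual_pred dual_pred_closed.

(* The character module Hom_Z(N, D). *)
Record dual := Dual { dual_val :> N -> D; dual_valP : dual_val \in dual_pred }.

HB.instance Definition _ := [isSub for dual_val].
HB.instance Definition _ := [Choice of dual by <:].
HB.instance Definition _ := [SubChoice_isSubZmodule of dual by <:].

Lemma dualP (f g : dual) : (forall x, f x = g x) -> f = g.
Proof. by move=> fg; apply/val_inj/funext. Qed.

Lemma dual_subE (f : dual) x y : f (x - y) = f x - f y.
Proof. by case: f => f /= /asboolP. Qed.

Lemma dual_addE (f : dual) x y : f (x + y) = f x + f y.
Proof.
by have := dual_subE f (x + y) y; rewrite addrK => ->; rewrite subrK.
Qed.

Lemma dual_scale_proof r (f : dual) : (fun x => f (r *: x)) \in dual_pred.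
Proof. by apply/asboolP => x y; rewrite scalerBr dual_subE. Qed.

Definition dual_scale r (f : dual) : dual := Dual (dual_scale_proof r f).

Lemma dual_scaleA r1 r2 f : dual_scale r1 (dual_scale r2 f) = dual_scale (r1 * r2) f.
Proof. by apply: dualP => x /=; rewrite scalerA mulrC. Qed.
Lemma dual_scale1 : left_id 1 dual_scale.
Proof. by move=> f; apply: dualP => x /=; rewrite scale1r. Qed.
Lemma dual_scaleDr : right_distributive dual_scale +%R.
Proof. by move=> r f g; apply: dualP => x. Qed.
Lemma dual_scaleDl f : {morph dual_scale^~ f : r1 r2 / r1 + r2}.
Proof. by move=> r1 r2; apply: dualP => x /=; rewrite scalerDl dual_addE. Qed.

HB.instance Definition _ := GRing.Zmodule_isLmodule.Build R dual
  dual_scaleA dual_scale1 dual_scaleDr dual_scaleDl.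

Lemma dualDE (f g : dual) x : (f + g) x = f x + g x. Proof. by []. Qed.
Lemma dualZE r (f : dual) x : (r *: f) x = f (r *: x). Proof. by []. Qed.
Lemma dual0E x : (0 : dual) x = 0. Proof. by []. Qed.

Lemma dual_of_additive (g : {additive N -> D}) : exists f : dual, forall x, f x = g x.
Proof.
have gP : (g : N -> D) \in dual_pred by apply/asboolP => x y; rewrite raddfB.
by exists (Dual gP).
Qed.

End Dual.

Lemma bilinear_pack (R : comNzRingType) (M A P : lmodType R) (f : M -> A -> P) :
  bilinear_for *:%R *:%R f -> exists b : {bilinear M -> A -> P}, forall m a, b m a = f m a.
Proof.
move=> fP.
pose b : {bilinear M -> A -> P} :=
  HB.pack f (bilinear_isBilinear.Build R M A P *:%R *:%R f fP).
by exists b.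
Qed.

(** * Valuation rings and flatness *)

Section Valuation.
Variables (R : comNzRingType) (hR : valuation_ring R).
Implicit Types a b c p q r s t z : R.

Definition nonunit p : Prop := forall b, p * b <> 1.
Definition regular r : Prop := forall t, t * r = 0 -> t = 0.

Lemma divides_total a b : (exists c, a = c * b) \/ (exists c, b = c * a).
Proof.
have [[A hA] [B hB]] := (cyclic_submodule (a : R^o), cyclic_submodule (b : R^o)).
by case: (hR A B) => AB; [left|right]; [apply/hB/AB/hA|apply/hA/AB/hB]; exists 1; rewrite scale1r.
Qed.

Lemma nonunit0 : nonunit 0.
Proof. by move=> b; rewrite mul0r => /esym/eqP; rewrite oner_eq0. Qed.

(** A valuation ring is local: if [1 - p l] were a multiple of [p], then [p] would be a unit; so
    [1 - p l] divides [p], hence also 1. *)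
Lemma unit_1sub p l : nonunit p -> exists b, (1 - p * l) * b = 1.
Proof.
move=> hp; case: (divides_total (1 - p * l) p) => [[c hc]|[c hc]].
  by case: (hp (c + l)); rewrite mulrDr [p * c]mulrC -hc subrK.
exists (1 + c * l); rewrite mulrDr mulr1 mulrA [_ * c]mulrC -hc.
by rewrite subrK.
Qed.

Lemma nakayama (M : lmodType R) (x : M) p l : nonunit p -> x = (p * l) *: x -> x = 0.
Proof.
move=> /(@unit_1sub _ l)[b hb] hx.
rewrite -[x]scale1r -hb mulrC -scalerA scalerBl scale1r -hx subrr.
by rewrite scaler0.
Qed.

Lemma nakayama_ring s p l : nonunit p -> s = s * (p * l) -> s = 0.
Proof. by move=> hp hs; apply: (@nakayama R^o s p l hp); rewrite {1}hs mulrC. Qed.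

Lemma zero_divisorP r : ~ regular r -> exists2 t, t <> 0 & t * r = 0.
Proof.
move=> h; apply: contrapT => h'; apply: h => t ht.
by apply: contrapT => tN0; apply: h'; exists t.
Qed.

Lemma unit_or_nonunit c : (exists b, c * b = 1) \/ nonunit c.
Proof.
have [|h] := pselect (exists b, c * b = 1); first by left.
by right=> b hb; apply: h; exists b.
Qed.

Lemma strict_divides_total s t :
  (exists c, s = c * t) \/ (exists2 c, nonunit c & t = c * s).
Proof.
case: (divides_total s t) => [|[c hc]]; first by left.
case: (unit_or_nonunit c) => [[b hb]|hu]; last by right; exists c.
by left; exists b; rewrite hc mulrA [b * c]mulrC hb mul1r.
Qed.

Lemma zero_divisor_nonunit z t : t <> 0 -> t * z = 0 -> nonunit z.
Proof. by move=> tN0 tz b zb; apply: tN0; rewrite -[t]mulr1 -zb mulrA tz mul0r. Qed.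

Lemma regularM r s : regular r -> regular s -> regular (r * s).
Proof. by move=> hr hs t; rewrite mulrA => /hs/hr. Qed.

Lemma regular_factor r s : regular (r * s) -> regular s.
Proof. by move=> h t ts; apply: h; rewrite mulrCA ts mulr0. Qed.

(** A divisor of a regular element is regular, so the zero-divisor [z] cannot divide [p]. *)
Lemma regular_divides p z u : regular p -> u <> 0 -> u * z = 0 -> exists c, z = c * p.
Proof.
move=> hp uN0 uz; case: (divides_total z p) => [//|[c hc]].
by case: uN0; apply: hp; rewrite hc mulrCA uz mulr0.
Qed.

(* Over a valuation ring this is equivalent to flatness. *)
Definition torsion_flat (N : lmodType R) : Prop :=
  forall s (x : N), s *: x = 0 -> exists t y, s * t = 0 /\ x = t *: y.

Lemma torsion_flat_ring : torsion_flat (R^o : lmodType R).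
Proof. by move=> s x sx; exists x, 1; split=> //; rewrite /GRing.scale /= mulr1. Qed.

(** A partial map [j |-> f] gives the additive map [j m |-> f m] on a subgroup of [N], which extends
    to [N] as a character. It is well defined: if [j m = 0], then [m = t w] with [j t = 0], so
    [t f = 0] and [f m = 0]. *)
Lemma dual_injective (N : lmodType R) (D : zmodType) :
  torsion_flat N -> divisible D -> injective_module (dual N D).
Proof.
move=> flatN divD H gH; have [sH iH] := gH.
pose G : set (N * D)%type := [set p | exists (j : R) (f : dual N D) (m : N),
  [/\ H (j, f), p.1 = j *: m & p.2 = f m]].
have HZ r j f : H (j, f) -> H (r * j, r *: f).
  by move=> h; apply: (issubZ sH r h).
have [||d|g hg] := @additive_extension N D G divD.
- exists 0, 0, 0; split; [exact: issub0 sH|by rewrite scale0r|by rewrite dual0E].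
- move=> [x d] [y e] [j [f [m [hjf /= -> ->]]]] [k [h [n [hkh /= -> ->]]]].
  case: (divides_total j k) => [[c jc]|[c kc]].
    have fE : f = c *: h by apply: (graphB gH hjf); rewrite jc; apply: HZ.
    exists k, h, (c *: m - n); split=> //=.
      by rewrite scalerBr scalerA [k * c]mulrC -jc.
    by rewrite fE dual_subE.
  have hE : h = c *: f by apply: (graphB gH hkh); rewrite kc; apply: HZ.
  exists j, f, (m - c *: n); split=> //=.
    by rewrite scalerBr scalerA [j * c]mulrC -kc.
  by rewrite hE dual_subE.
- move=> [j [f [m [hjf /= /esym/flatN[t [w [jt ->]]] ->]]]].
  have tf0 : t *: f = 0 by apply: iH; rewrite -jt mulrC; apply: HZ.
  by rewrite -dualZE tf0.
have [x xE] := dual_of_additive g.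
exists x => r f hrf; apply: dualP => m; rewrite dualZE xE; apply/esym/hg.
by exists r, f, m.
Qed.

(* If h tau = 0, embed TA in a divisible group D. As Hom_Z(N, D) is injective, the
   pairing of N and A into D extends along f to one of N and B; it factors through
   TB, so it kills tau, and the embedding of TA in D forces tau = 0. *)
Lemma torsion_flat_flat (N : lmodType R) : torsion_flat N -> flat N.
Proof.
move=> flatN A B f finj TA TB tA tB hTA hTB h hE.
apply: raddf_inj => tau htau.
have [D [i [divD inji]]] := divisible_embedding TA.
have [gf gfP] : exists g : {linear B -> dual N D},
    forall (a : A) (m : N), g (f a) m = i (tA m a).
  have val_f (a : A) : exists F : dual N D, forall m : N, F m = i (tA m a).
    have FP : (fun m => i (tA m a)) \in @dual_pred R N D.
      by apply/asboolP => x y; rewrite linearBl raddfB.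
    by exists (Dual FP).
  pose G : set (B * dual N D)%type :=
    [set p : (B * dual N D)%type | exists a : A, p.1 = f a /\ forall m : N, p.2 m = i (tA m a)].
  have [||g hg] := @injective_extension R B (dual N D) G.
  - exact: dual_injective.
  - split; [split|].
    + by exists 0; split=> [|m]; rewrite !linear0 ?raddf0.
    + move=> r [x F] [y K] [a [/= -> hF]] [b [/= -> hK]].
      exists (r *: a + b); split=> [|m]; first by rewrite linearP.
      by rewrite dualDE dualZE hF hK -raddfD linearPr linearZl_LR.
    + move=> F [a [/= /esym/eqP fa hF]]; apply: dualP => m.
      rewrite hF; suff -> : a = 0 by rewrite linear0r raddf0.
      by apply: finj; rewrite linear0; apply/eqP.
  exists g => a m; have [F hF] := val_f a.
  by rewrite (hg (f a) F) //; exists a.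
(* Values in the group [D] are replaced by characters of [R], so that the pairings become bilinear
   over [R]; evaluation at 1 recovers them. *)
pose P : lmodType R := dual (R^o : lmodType R) D.
have bP (m : N) (b : B) : (fun r : R^o => gf b (r *: m)) \in @dual_pred R R^o D.
  by apply/asboolP => x y; rewrite scalerBl dual_subE.
have [bb bbE] : exists bb : {bilinear N -> B -> P},
    forall (m : N) (b : B) (r : R^o), bb m b r = gf b (r *: m).
  have [|bb hbb] := @bilinear_pack R N B P (fun (m : N) (b : B) => Dual (bP m b) : P).
    split=> [b|m] k x y; apply: dualP => r; rewrite dualDE dualZE /=.
      by rewrite scalerDr dual_addE scalerA mulrC.
    by rewrite linearP dualDE dualZE scalerA.
  by exists bb => m b r; rewrite hbb.
have [g [gE _]] := hTB P bb.
have iP (x : TA) : (fun r : R^o => i (r *: x)) \in @dual_pred R R^o D.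
  by apply/asboolP => r s; rewrite scalerBl raddfB.
have [k kE] : exists k : {linear TA -> P}, forall (x : TA) (r : R^o), k x r = i (r *: x).
  pose k0 (x : TA) : P := Dual (iP x).
  have k0P : linear k0.
    by move=> c x y; apply: dualP => r; rewrite dualDE dualZE /= scalerDr raddfD scalerA mulrC.
  by exists (HB.pack k0 (GRing.isLinear.Build R TA P *:%R k0 k0P) : {linear TA -> P}).
have [bA bAE] : exists bA : {bilinear N -> A -> P}, forall (m : N) (a : A), bA m a = k (tA m a).
  apply: bilinear_pack; split=> [a|m] c x y.
    by rewrite linearPl linearP.
  by rewrite linearPr linearP.
have [u [_ uU]] := hTA P bA.
have kh : g (h tau) = k tau.
  rewrite (uU k) // -(uU (g \o h : {linear TA -> P})) // => m a.
  by rewrite /= hE gE bAE; apply: dualP => r; rewrite bbE gfP kE linearZl_LR.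
apply: inji; rewrite raddf0 -[tau]scale1r -kE -kh htau linear0.
by rewrite dual0E.
Qed.

End Valuation.

(* R embeds in the injective module Hom_Z(R, D), for D a divisible group
   containing R. A maximal essential extension of R there is complemented by any
   submodule that is maximal among those meeting it trivially, so it is injective. *)
Lemma injective_hull (R : comNzRingType) (hR : valuation_ring R) :
  exists (E : lmodType R) (e : E), [/\ injective_module E,
    forall r, r *: e = 0 -> r = 0 &
    forall y, y <> 0 -> exists s u, s *: y = u *: e /\ u <> 0].
Proof.
have [D [i [divD inji]]] := divisible_embedding R.
pose E0 : lmodType R := dual (R^o : lmodType R) D.
have injE0 : injective_module E0 := dual_injective hR (@torsion_flat_ring R) divD.
have [e0 e0E] : exists e0 : E0, forall r, e0 r = i r.
  exact: (@dual_of_additive R (R^o : lmodType R) D i).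
have e0_ann r : r *: e0 = 0 -> r = 0.
  move=> re0; apply: inji; rewrite raddf0 -[r]mulr1 -e0E.
  by rewrite -[LHS]/((r *: e0 : E0) 1) re0 dual0E.
have [||X [sX e0X XQ Xmax]] := @max_sub R E0
    [set y | y <> 0 -> exists s u, s *: y = u *: e0 /\ u <> 0]
    [set y | exists r, y = r *: e0].
- split; first by exists 0; rewrite scale0r.
  by move=> r _ _ [a ->] [b ->]; exists (r * a + b); rewrite scalerDl scalerA.
- move=> _ [r ->] re0N0; exists 1, r; rewrite scale1r; split=> // r0.
  by apply: re0N0; rewrite r0 scale0r.
have [||K [sK _ KX Kmax]] := @max_sub R E0 [set y | X y -> y = 0] [set 0].
- by split=> // r x y /= -> ->; rewrite scaler0 addr0.
- by move=> x /= ->.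
have decomp x0 : exists2 x1, X x1 & K (x0 - x1).
  (* This partial map sends [r] to the component of [r x0] in [X] whenever [r x0] lies in [X + K].
     Injectivity of [E0] gives it the form [r |-> r x1], and [x1] is the required component of
     [x0]. *)
  pose H : set (R^o * E0)%type := [set p | X p.2 /\ K (p.1 *: x0 - p.2)].
  have gH : graph H.
    split; [split|].
    - by split=> /=; rewrite ?scale0r ?subr0; [apply: issub0 sX|apply: issub0 sK].
    - move=> r [a y] [b z] [/= Xy Ky] [/= Xz Kz]; split=> /=; first exact: sX.2.
      suff <- : r *: (a *: x0 - y) + (b *: x0 - z) =
          (r *: (a : R^o) + b) *: x0 - (r *: y + z) by apply: sK.2.
      by rewrite scalerBr scalerDl scalerA opprD addrACA.
    - move=> y [/= Xy]; rewrite scale0r sub0r => /(issubN sK); rewrite opprK => Ky.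
      exact: KX.
  have [x1 hx1] := injE0 _ gH.
  have Xx1 : X x1.
    apply: Xmax => r k Xk /= yN0.
    (* As [k + r x0] is outside [K], maximality of [K] gives a nonzero [v] in [X] congruent modulo
       [K] to a multiple [s (k + r x0)]. Then [v = s (k + r x1)], and essentiality of [X] applies to
       [v]. *)
    have nK : ~ K (k + r *: x0).
      move=> hk; apply: yN0; suff <- : - k = r *: x1 by rewrite subrr.
      by apply: hx1; split=> /=; [apply: issubN|rewrite opprK addrC].
    have [s [k' [Kk' Xv vN0]]] : exists s k', [/\ K k', X (k' + s *: (k + r *: x0)) &
        k' + s *: (k + r *: x0) <> 0].
      apply: contrapT => h; apply: nK; apply: Kmax => s k' Kk' /= Xv.
      by apply: contrapT => vN0; apply: h; exists s, k'.
    have vE : k' + s *: (k + r *: x0) = s *: (k + r *: x1).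
      rewrite [RHS]scalerDr scalerA -(hx1 (s * r) (k' + s *: (k + r *: x0) - s *: k)).
        by rewrite [RHS]addrC subrK.
      split=> /=; first by apply: issubB => //; apply: issubZ.
      suff -> : (s * r) *: x0 - (k' + s *: (k + r *: x0) - s *: k) = - k' by apply: issubN.
      by rewrite scalerDr scalerA addrA addrAC addrK opprD addrCA subrr addr0.
    have [//|t [u [hu uN0]]] := XQ _ Xv.
    by exists (t * s), u; rewrite -scalerA -vE.
  exists x1 => //; apply: Kmax => s k' Kk' /= Xv.
  have := hx1 s (k' + s *: (x0 - x1) + s *: x1).
  have -> : k' + s *: (x0 - x1) + s *: x1 = k' + s *: x0 by rewrite scalerBr addrA subrK.
  move=> h; apply/eqP; rewrite scalerBr addrA subr_eq0; apply/eqP/h; split=> /=.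
    suff -> : k' + s *: x0 = (k' + s *: (x0 - x1)) + s *: x1.
      by apply: issubD => //; apply: issubZ.
    by rewrite scalerBr addrA subrK.
  by rewrite opprD addrCA subrr addr0; apply: issubN.
have [N NX] := issub_submodClosed sX.
pose E : lmodType R := submod N.
have e0N : e0 \in N by apply/NX/e0X; exists 1; rewrite scale1r.
exists E, (Submod e0N); split.
- move=> H [sH iH].
  have [|x0 hx0] := injE0 [set p | exists2 y : E, p.2 = val y & H (p.1, y)].
    split; [split|].
    - by exists 0 => //; apply: issub0 sH.
    - move=> r [a y] [b z] [y' /= -> hy] [z' /= -> hz].
      by exists (r *: y' + z') => //; apply: (sH.2 r (a, y') (b, z')).
    - by move=> y [z /= -> /iH ->].
  have [x1 Xx1 Kx] := decomp x0.
  have x1N : x1 \in N by apply/NX.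
  exists (Submod x1N : E) => r y hy; apply: val_inj => /=.
  apply/eqP; rewrite -subr_eq0; apply/eqP/KX.
    have -> : val y = r *: x0 by apply: hx0; exists y.
    by rewrite -scalerBr; apply: issubZ.
  by apply: issubB => //; [apply/NX/valP|apply: issubZ].
- by move=> r /(congr1 val) /= /e0_ann.
- move=> y yN0; have [|s [u [h uN0]]] := XQ (val y) (iffLR (NX _) (valP y)).
    by move=> h; apply: yN0; apply: val_inj.
  by exists s, u; split=> //; apply: val_inj.
Qed.

(** * Immediate extensions *)

Section Content.
Variables (R : comNzRingType) (hR : valuation_ring R).

Lemma common_divisor (I : eqType) (s : seq I) (c : I -> R) : s != [::] ->
  exists2 i, i \in s & forall j, j \in s -> exists d, c j = d * c i.
Proof.
elim: s => [//|i s ih] _; have [->|/ih[k ks hk]] := eqVneq s [::].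
  exists i; rewrite ?mem_head // => j; rewrite inE => /eqP ->.
  by exists 1; rewrite mul1r.
case: (divides_total hR (c i) (c k)) => [[d hd]|[d hd]].
  exists k; first by rewrite inE ks orbT.
  by move=> j; rewrite inE => /predU1P[->|/hk //]; exists d.
exists i; rewrite ?mem_head // => j; rewrite inE => /predU1P[->|/hk[b ->]].
  by exists 1; rewrite mul1r.
by exists (b * d); rewrite hd mulrA.
Qed.

Lemma in_mulZ (M : lmodType R) (A : {pred R}) a (x : M) : a \in A -> in_mul A (a *: x).
Proof. by move=> aA; exists 1, (fun=> a), (fun=> x); rewrite big_ord1. Qed.

(** One of the coefficients divides all the others and can be factored out of the sum. *)
Lemma in_mul_inv (M : lmodType R) (A : {pred R}) (x : M) : in_mul A x ->
  x = 0 \/ exists a y, a \in A /\ x = a *: y.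
Proof.
move=> [[|n] [a [m [aA ->]]]]; first by left; rewrite big_ord0.
right; have [|i _ hi] := @common_divisor _ (enum 'I_n.+1) a.
  by rewrite -size_eq0 size_enum_ord.
have [d hd] := choice (fun j => hi j (mem_enum _ j)).
exists (a i), (\sum_j d j *: m j); split=> //; rewrite scaler_sumr.
by apply: eq_bigr => j _; rewrite hd scalerA mulrC.
Qed.

Lemma idealMl (A : ideal R) c a : a \in A -> c * a \in A.
Proof. by move=> aA; have := @rpredZ R R^o A c a aA. Qed.

Lemma contentP (M : lmodType R) (x : M) r :
  r \in content x <-> forall A : ideal R, in_mul A x -> r \in A.
Proof. by split=> [/asboolP|h]; last apply/asboolP. Qed.

Section FreeModules.
Variable F : lmodType R.

Lemma free_coordinate (X : set F) (x0 : F) :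
  linearly_independent X -> spanning X -> exists g : {linear F -> R^o},
    forall s : seq (R * F), (forall p, p \in s -> X p.2) ->
      g (\sum_(p <- s) p.1 *: p.2) = \sum_(p <- s) p.1 *+ (p.2 == x0).
Proof.
move=> indX spanX.
have wd (s : seq (R * F)) : (forall p, p \in s -> X p.2) ->
    \sum_(p <- s) p.1 *: p.2 = 0 -> \sum_(p <- s) p.1 *+ (p.2 == x0) = 0.
  move=> sX s0; pose U := undup [seq p.2 | p <- s].
  pose c x := \sum_(p <- s) p.1 *+ (p.2 == x).
  have cU : \sum_(x <- U) c x *: x = 0.
    rewrite -[RHS]s0; under eq_bigr do rewrite scaler_suml.
    rewrite exchange_big /=; apply: eq_big_seq => p ps.
    have pU : p.2 \in U by rewrite mem_undup map_f.
    rewrite (bigD1_seq _ pU (undup_uniq _)) /= eqxx big1 ?addr0 // => y.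
    by rewrite eq_sym => /negbTE ->; rewrite scale0r.
  have [x0U|x0U] := boolP (x0 \in U).
    apply: (indX U c (undup_uniq _) _ cU) => // x.
    by rewrite mem_undup => /mapP[p /sX Xp ->].
  rewrite big_seq big1 // => p ps; case: eqP => // px0.
  by case/negP: x0U; rewrite mem_undup -px0 map_f.
have [|||g hg] := @linear_of_rel R F R^o (fun y a => exists s : seq (R * F),
  [/\ forall p, p \in s -> X p.2, y = \sum_(p <- s) p.1 *: p.2 &
      a = \sum_(p <- s) p.1 *+ (p.2 == x0)]).
- move=> y; have [s [c [sX ->]]] := spanX y.
  exists (\sum_(x <- s) c x *+ (x == x0)), [seq (c x, x) | x <- s].
  by rewrite !big_map; split=> // p /mapP[x /sX Xx ->].
- move=> r _ _ _ _ [s [sX -> ->]] [t [tX -> ->]].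
  exists ([seq (r * p.1, p.2) | p <- s] ++ t).
  rewrite !big_cat !big_map /= !scaler_sumr; split.
  + by move=> p; rewrite mem_cat => /orP[/mapP[q /sX Xq ->]|/tX].
  + by congr (_ + _); apply: eq_bigr => p _; rewrite scalerA.
  + by congr (_ + _); apply: eq_bigr => p _; rewrite /GRing.scale /= mulrnAr.
- by move=> b [s [sX /esym s0 ->]]; apply: wd.
by exists g => s sX; apply/hg; exists s.
Qed.

(** Take for [q] a coefficient of [y] dividing all the others, say at [x0]. The quotient [v] has
    coefficient 1 at [x0], and [g] is the coordinate at [x0]. *)
Lemma free_primitive (y : F) : free_module F -> y <> 0 ->
  exists q v (g : {linear F -> R^o}), y = q *: v /\ g v = 1.
Proof.
move=> [X [indX spanX]] yN0; have [s [c [sX yE]]] := spanX y.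
pose U := undup s; pose c' x := c x *+ count_mem x s.
have {}yE : y = \sum_(x <- U) c' x *: x.
  rewrite yE -[LHS]big_undup_iterop_count; apply: eq_bigr => x _.
  by rewrite -[LHS]/((c x *: x) *+ count_mem x s) scalerMnl.
have UX x : x \in U -> X x by rewrite mem_undup; apply: sX.
have [|x0 x0U hx0] := @common_divisor _ U c'.
  by apply/eqP => U0; apply: yN0; rewrite yE U0 big_nil.
have [d [d0 dE]] : exists d : F -> R, d x0 = 1 /\ forall x, x \in U -> c' x = d x * c' x0.
  have : forall x, exists b, (x = x0 -> b = 1) /\ (x \in U -> c' x = b * c' x0).
    move=> x; have [->|/eqP xN] := eqVneq x x0; first by exists 1; rewrite mul1r.
    have [/hx0[b hb]|xU] := boolP (x \in U); first by exists b; split.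
    by exists 0; split.
  by move=> /choice[d hd]; exists d; split; [apply: (hd x0).1|move=> x; apply: (hd x).2].
have [g hg] := @free_coordinate X x0 indX spanX.
exists (c' x0), (\sum_(x <- U) d x *: x), g; split.
  rewrite yE scaler_sumr; apply: eq_big_seq => x /dE ->.
  by rewrite scalerA mulrC.
have := hg [seq (d x, x) | x <- U]; rewrite !big_map /= => ->.
  rewrite (bigD1_seq _ x0U (undup_uniq _)) /= eqxx d0 big1 ?addr0 // => x.
  by move/negbTE ->.
by move=> p /mapP[x /UX Xx ->].
Qed.

End FreeModules.

(* N is an immediate extension of R e, and R e is free and pure in N. *)
Definition immediate (N : lmodType R) (e : N) : Prop :=
  (forall y : N, exists q p m, nonunit p /\ y = q *: (e + p *: m)) /\
  (forall s p (m : N), nonunit p -> s *: e = (s * p) *: m -> s = 0).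

Section Immediate.
Variables (N : lmodType R) (e : N) (hN : immediate e).

Lemma immediate_torsion_flat : torsion_flat N.
Proof.
move=> s y sy; have [q [p [m [hp yE]]]] := hN.1 y.
exists q, (e + p *: m); split=> //.
apply: (hN.2 (s * q) p (- m) hp); apply/eqP.
by rewrite scalerN -addr_eq0 -!scalerA -!scalerDr -yE sy.
Qed.

(** The content of [y = q (e + p m)] is [R q]. Indeed if [y = a w] with [a = c q] and [c] a nonunit,
    then [q e] is a nonunit multiple of [q] in [N], so [q = 0] by purity. *)
Lemma immediate_content : content_module N.
Proof.
move=> y; have [q [p [m [hp yE]]]] := hN.1 y.
rewrite {2}yE; apply: in_mulZ; apply/contentP => A /in_mul_inv[y0|[a [w [aA yw]]]].
  suff -> : q = 0 by apply: rpred0.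
  apply: (hN.2 q p (- m) hp); apply/eqP.
  by rewrite scalerN -addr_eq0 -!scalerA -!scalerDr -yE y0.
case: (strict_divides_total hR q a) => [[c ->]|[c hc aE]].
  exact: idealMl.
suff -> : q = 0 by apply: rpred0.
case: (divides_total hR c p) => [[d dE]|[d dE]].
  apply: (hN.2 q p (d *: w - m) hp); apply/eqP.
  rewrite scalerBr eq_sym subr_eq eq_sym.
  rewrite -[(q * p) *: m]scalerA -scalerDr -yE yw aE dE scalerA.
  by apply/eqP; congr (_ *: _); ring.
apply: (hN.2 q c (w - d *: m) hc); apply/eqP.
rewrite scalerBr eq_sym subr_eq eq_sym scalerA -mulrA [c * d]mulrC -dE.
rewrite -[(q * p) *: m]scalerA -scalerDr -yE yw aE.
by rewrite mulrC.
Qed.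

(** The image of [e] in the free module is [q v], where some linear form is 1 at [v]. Purity makes
    [q] a unit, since [e = q (pi v)]; rescaling the form gives value 1 at [e]. *)
Lemma immediate_functional : locally_projective N ->
  exists g : {linear N -> R^o}, g e = 1.
Proof.
move=> lpN.
have e_neq0 : e <> 0.
  move=> e0; have /eqP := oner_neq0 R; apply.
  by apply: (hN.2 1 0 e (@nonunit0 R)); rewrite e0 !scaler0.
have [A hA] := cyclic_submodule e.
have [|F [phi [pi [freeF hF]]]] := lpN A.
  exists 1, (fun=> e) => x; split=> [/hA[r ->]|[r ->]].
    by exists (fun=> r); rewrite big_ord1.
  by rewrite big_ord1; apply/hA; exists (r ord0).
have pie : pi (phi e) = e by apply: hF; apply/hA; exists 1; rewrite scale1r.
have [|q [v [g [phiE gv]]]] := @free_primitive F (phi e) freeF.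
  by move=> phie0; apply: e_neq0; rewrite -pie phie0 linear0.
have [[b qb]|hq] := unit_or_nonunit q; last first.
  have /eqP := oner_neq0 R; case; apply: (hN.2 1 q (pi v) hq).
  by rewrite scale1r mul1r -linearZ -phiE pie.
have [|||f hf] := @linear_of_rel R N R^o (fun x a => a = b * g (phi x)).
- by move=> x; exists (b * g (phi x)).
- move=> r x a y c -> ->; rewrite !linearP /= mulrDr; congr (_ + _).
  by rewrite /GRing.scale /= mulrCA.
- by move=> a ->; rewrite !linear0 mulr0.
exists f; apply/hf; have -> : g (phi e) = q by rewrite phiE linearZ gv; apply: mulr1.
by rewrite mulrC.
Qed.

End Immediate.
End Content.

(** * The injective hull of a valuation ring *)

Section Hull.
Variables (R : comNzRingType) (hR : valuation_ring R) (E : lmodType R) (e : E).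
Hypothesis injE : injective_module E.
Hypothesis e_ann : forall r, r *: e = 0 -> r = 0.
Hypothesis essE : forall y, y <> 0 -> exists s u, s *: y = u *: e /\ u <> 0.

(** The hypothesis makes [t q |-> t y] a well-defined map on the ideal [R q]; injectivity extends it
    to [R]. *)
Lemma hull_divide (q : R) (y : E) :
  (forall t, t * q = 0 -> t *: y = 0) -> exists x, y = q *: x.
Proof.
move=> qy; have [|x hx] := injE (H := [set p | exists t, p.1 = t * q /\ p.2 = t *: y]).
  split; [split|].
  - by exists 0; rewrite /= mul0r scale0r.
  - move=> r [a u] [b v] [t [/= -> ->]] [t' [/= -> ->]]; exists (r * t + t').
    by rewrite /= mulrDl scalerDl -scalerA -mulrA.
  - by move=> u [t [/= /esym/qy ty ->]].
by exists x; apply: hx; exists 1; rewrite /= mul1r scale1r.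
Qed.

Lemma hull_regular (r : R) (y : E) : regular r -> r *: y = 0 -> y = 0.
Proof.
move=> hr ry; apply: contrapT => /essE[s [u [sy uN0]]]; apply/uN0/hr/e_ann.
by rewrite mulrC -scalerA -sy scalerA mulrC -scalerA ry scaler0.
Qed.

(** Let [t q = 0]. As [q s] is nonzero, [s] is not a multiple of [t], so [t = c s] and
    [t y = t q e = 0]; hence [hull_divide] applies. *)
Lemma hull_quotient (s q : R) (y : E) :
  s *: y = (q * s) *: e -> q * s <> 0 -> exists x, y = q *: x.
Proof.
move=> sy qsN0; apply: hull_divide => t tq.
case: (divides_total hR s t) => [[c sE]|[c tE]].
  by case: qsN0; rewrite sE mulrCA [q * t]mulrC tq mulr0.
rewrite tE -scalerA sy scalerA; suff -> : c * (q * s) = t * q by rewrite tq scale0r.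
by rewrite tE; ring.
Qed.

(* The multiples of zero-divisors: the submodule Z E, for Z the prime ideal of
   zero-divisors. *)
Definition zd_multiple (y : E) : Prop := exists z x, ~ regular z /\ y = z *: x.


Lemma zd_multiple_sub : issub zd_multiple.
Proof.
split; first by exists 0, 0; rewrite scaler0; split=> // /(_ 1 (mulr0 1))/eqP; rewrite oner_eq0.
move=> r _ _ [z [x [hz ->]]] [z' [x' [hz' ->]]].
case: (divides_total hR z z') => [[c ->]|[c ->]].
  exists z', ((r * c) *: x + x'); split=> //.
  by rewrite scalerDr !scalerA; congr (_ *: _ + _); ring.
exists z, (r *: x + c *: x'); split=> //.
by rewrite scalerDr !scalerA; congr (_ *: _ + _ *: _); ring.
Qed.

(** Essentiality gives [s n = v e] with [v] nonzero. Then [u = c s] and [c v = 0], which forces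
    [v = q s]; so [n] is a multiple of [q], and [u q = c v = 0]. *)
Lemma zd_multiple_killed (u : R) (n : E) : u *: n = 0 -> u <> 0 -> zd_multiple n.
Proof.
move=> un uN0; have [->|nN0] := pselect (n = 0); first exact: issub0 zd_multiple_sub.
have [s [v [sn vN0]]] := essE nN0.
have [c uE] : exists c, u = c * s.
  case: (divides_total hR u s) => [//|[c sE]].
  by case: vN0; apply: e_ann; rewrite -sn sE -scalerA un scaler0.
have cv : c * v = 0 by apply: e_ann; rewrite -scalerA -sn scalerA -uE un.
case: (divides_total hR v s) => [[q vE]|[q sE]].
  have [||x nE] := @hull_quotient s q n; rewrite -?vE //.
  exists q, x; split=> // hq; apply/uN0/hq.
  by rewrite uE -mulrA [s * q]mulrC -vE.
by case: uN0; rewrite uE sE mulrCA cv mulr0.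
Qed.

(** Let [n = z x] and [w z = 0] with [w] nonzero. If [w] were a multiple of [t], it would kill
    [e + n] and so [e]; hence [t] is a multiple of [w], and [t e = t (e + n) = 0]. *)
Lemma zd_perturbation_ann (t : R) (n : E) : zd_multiple n -> t *: (e + n) = 0 -> t = 0.
Proof.
move=> [z [x [/zero_divisorP[w wN0 wz] ->]]] h.
case: (divides_total hR w t) => [[c wE]|[c tE]].
  case: wN0; apply: e_ann; have := congr1 (fun y => c *: y) h.
  by rewrite scaler0 scalerA -wE scalerDr scalerA wz scale0r addr0.
by apply: e_ann; rewrite -h scalerDr scalerA {3}tE -mulrA wz mulr0 scale0r addr0.
Qed.

(** In [s y = u e] with [u] nonzero, either [u = q s] and [y] is divisible by [q], or [s = p u]. In
    both cases the error term [n] is killed by [u], hence lies in [Z E]. *)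
Lemma hull_structure (y : E) :
  (exists q n, zd_multiple n /\ y = q *: (e + n)) \/
  (exists p n, [/\ regular p, zd_multiple n & p *: y = e + n]).
Proof.
have [->|yN0] := pselect (y = 0).
  by left; exists 0, 0; rewrite scale0r; split=> //; apply: issub0 zd_multiple_sub.
have [s [u [sy uN0]]] := essE yN0.
case: (divides_total hR u s) => [[q uE]|[p sE]].
  left; have [||x yE] := @hull_quotient s q y; rewrite -?uE //.
  exists q, (x - e); rewrite [e + _]addrC subrK; split=> //.
  apply: zd_multiple_killed uN0; rewrite scalerBr -sy yE scalerA uE.
  by rewrite [q * s]mulrC subrr.
right; have Zn : zd_multiple (p *: y - e).
  by apply: zd_multiple_killed uN0; rewrite scalerBr -sy scalerA [u * p]mulrC -sE subrr.
exists p, (p *: y - e); split=> //; last by rewrite [RHS]addrC subrK.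
move=> t tp; apply: (zd_perturbation_ann Zn).
by rewrite [e + _]addrC subrK scalerA tp scale0r.
Qed.

Definition zd_neighbourhood (y : E) : Prop :=
  exists l n, zd_multiple n /\ y = l *: e + n.

Lemma zd_neighbourhood_sub : issub zd_neighbourhood.
Proof.
split; first by exists 0, 0; rewrite scale0r addr0; split=> //; apply: issub0 zd_multiple_sub.
move=> r _ _ [l [n [hn ->]]] [k [m [hm ->]]].
exists (r * l + k), (r *: n + m); split; first exact: zd_multiple_sub.2.
by rewrite scalerDr scalerDl scalerA addrACA.
Qed.

Lemma zd_neighbourhood_near n : zd_multiple n -> zd_neighbourhood (e + n).
Proof. by move=> hn; exists 1, n; rewrite scale1r. Qed.

(** Write [n = z y]. When [p y = e + n'] with [p] regular, [z = c p] and [c] is again a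
    zero-divisor. *)
Lemma zd_multiple_nonunit n : zd_multiple n ->
  exists p m, [/\ nonunit p, zd_neighbourhood m & n = p *: m].
Proof.
move=> [z [y [hz ->]]]; have [u uN0 uz] := zero_divisorP hz.
case: (hull_structure y) => [[q [n' [hn' ->]]]|[p [n' [hp hn' yE]]]].
  exists z, (q *: (e + n')); split=> //; first exact: zero_divisor_nonunit uz.
  exact/(issubZ zd_neighbourhood_sub)/zd_neighbourhood_near.
have [c zE] := regular_divides hR hp uN0 uz.
exists c, (e + n'); split; last by rewrite zE -scalerA yE.
  by apply: (zero_divisor_nonunit uN0); apply: hp; rewrite -mulrA -zE.
exact: zd_neighbourhood_near.
Qed.

(** The case to exclude is [p y = e + n'] with [p] a nonunit: for [y = l e + n] the unit [1 - p l]
    would bring [e] into [Z E], and [e + (- e)] would have zero annihilator. *)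
Lemma zd_neighbourhood_immediate y : zd_neighbourhood y ->
  exists q p m, [/\ nonunit p, zd_neighbourhood m & y = q *: (e + p *: m)].
Proof.
have near q n : zd_multiple n -> exists q' p m,
    [/\ nonunit p, zd_neighbourhood m & q *: (e + n) = q' *: (e + p *: m)].
  by move=> /zd_multiple_nonunit[p [m [hp hm ->]]]; exists q, p, m.
move=> [l [n [hn yE]]].
case: (hull_structure y) => [[q [n' [hn' ->]]]|[p [n' [hp hn' pyE]]]]; first exact: near.
case: (unit_or_nonunit p) => [[b pb]|hpu].
  suff -> : y = b *: (e + n') by apply: near.
  by rewrite -pyE scalerA mulrC pb scale1r.
have [b hb] := unit_1sub hR l hpu.
have Ze : zd_multiple (- e).
  suff -> : - e = b *: (n' - p *: n).
    apply/(issubZ zd_multiple_sub)/(issubB zd_multiple_sub) => //.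
    exact: issubZ zd_multiple_sub _ _ _.
  have -> : n' - p *: n = (p * l - 1) *: e.
    apply/eqP; rewrite scalerBl scale1r subr_eq addrAC eq_sym subr_eq -scalerA -scalerDr.
    by rewrite -yE pyE addrC.
  by rewrite scalerA -opprB mulrN mulrC hb scaleN1r.
have := @zd_perturbation_ann 1 _ Ze; rewrite subrr scaler0 => /(_ erefl)/eqP.
by rewrite oner_eq0.
Qed.

(** For [m = l e + n] and [b] inverse to [1 - p l], the equation says that [s (1 - p l)] kills
    [e - b p n], whose annihilator is zero. *)
Lemma zd_neighbourhood_pure s p m : nonunit p -> zd_neighbourhood m ->
  s *: e = (s * p) *: m -> s = 0.
Proof.
move=> hp [l [n [hn ->]]] h; have [b hb] := unit_1sub hR l hp.
suff : s * (1 - p * l) = 0 by move=> h0; rewrite -[s]mulr1 -hb mulrA h0 mul0r.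
apply: (@zd_perturbation_ann _ (- ((b * p) *: n))).
  exact/(issubN zd_multiple_sub)/(issubZ zd_multiple_sub).
have sE : (s * (1 - p * l)) *: e = (s * p) *: n.
  by rewrite mulrBr mulr1 scalerBl h scalerDr scalerA mulrA addrC addKr.
rewrite scalerDr sE scalerN scalerA -scalerBl -[RHS](scale0r n); congr (_ *: _).
apply/eqP; rewrite subr_eq0; apply/eqP.
have -> : s * p = s * ((1 - p * l) * b) * p by rewrite hb mulr1.
by ring.
Qed.

End Hull.

(** * Systems of congruences *)

Section Systems.
Variables (R : comNzRingType) (hR : valuation_ring R).

(* A pair (a, r) stands for the coset a + R r. *)
Definition consistent (S : set (R * R)) : Prop :=
  forall p q, S p -> S q -> exists c d, p.1 + p.2 * c = q.1 + q.2 * d.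

Definition solvable (S : set (R * R)) : Prop :=
  exists z, forall p, S p -> exists c, z = p.1 + p.2 * c.

Lemma consistent_le (S : set (R * R)) p q t : consistent S -> S p -> S q ->
  p.2 = t * q.2 -> exists c, p.1 = q.1 + q.2 * c.
Proof.
move=> cS Sp Sq pq; have [c [d h]] := cS p q Sp Sq.
exists (d - t * c); rewrite -[LHS](addrK (p.2 * c)) h pq; ring.
Qed.

Lemma idealB (A : ideal R) x y : x \in A -> y \in A -> x - y \in A.
Proof. exact: (issubB (issub_mem A)). Qed.

(** If there is no common point, each [a i] is missed by some coset [j]. With [r = a i - a j], the
    principal coset [a j + R r] contains coset [j] and lies in coset [i]; so it suffices to solve
    the principal cosets that contain a given one. *)
Lemma maximal_of_solvable : (forall S, consistent S -> solvable S) -> maximal_ring R.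
Proof.
move=> solv I a L fip; apply: contrapT => nosol.
have meet i j : exists y, y - a i \in L i /\ y - a j \in L j.
  have [|y hy] := fip [set i; j]; first exact: finite_set2.
  by exists y; split; apply: hy; [left|right].
have finer i : exists j r, [/\ r \in L i, r \notin L j & a j - a i \in L i].
  have [j hj] : exists j, a i - a j \notin L j.
    apply: contrapT => h; apply: nosol; exists (a i) => j _ /=.
    by apply: contrapT => /negP hj; apply: h; exists j.
  have [y [yi yj]] := meet i j.
  have Lji : {subset L j <= L i}.
    case: (hR (L i) (L j)) => // Lij; case/negP: hj.
    have -> : a i - a j = (y - a j) - (y - a i) by ring.
    by apply: idealB => //; apply: Lij.
  have aji : a j - a i \in L i.
    have -> : a j - a i = (y - a i) - (y - a j) by ring.
    by apply: idealB => //; apply: Lji.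
  exists j, (a i - a j); split=> //.
  by rewrite -opprB; apply: (issubN (issub_mem (L i))).
pose S : set (R * R) :=
  [set p | exists j, forall y, y - a j \in L j -> exists c, y = p.1 + p.2 * c].
have [p q [j hj] [k hk]|z hz] := solv S.
  have [y [yj yk]] := meet j k.
  have [c yc] := hj y yj; have [d yd] := hk y yk.
  by exists c, d; rewrite -yc.
apply: nosol; exists z => i _ /=.
have [j [r [ri rj aji]]] := finer i.
have [|c ->] := hz (a j, r).
  exists j => y yj; have [[c yE]|[c rE]] := divides_total hR (y - a j) r.
    by exists c; rewrite /= mulrC -yE addrC subrK.
  by case/negP: rj; rewrite rE; apply: idealMl.
rewrite /coset /=; have -> : a j + r * c - a i = (a j - a i) + c * r by ring.
by apply: (issubD (issub_mem (L i))) => //; apply: idealMl.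
Qed.

Hypothesis flat_content_lp : forall M : lmodType R,
  flat M -> content_module M -> locally_projective M.

(** Local projectivity of [P] gives a linear form with value 1 at [e]; its value at [x] is [z], and
    its value at [m] is [c]. *)
Lemma immediate_solution (W : lmodType R) (P : set W) (e x : W) : issub P -> P e -> P x ->
  (forall y, P y -> exists q p m, [/\ nonunit p, P m & y = q *: (e + p *: m)]) ->
  (forall s p m, nonunit p -> P m -> s *: e = (s * p) *: m -> s = 0) ->
  exists z : R, forall a r m, P m -> x = a *: e + r *: m -> exists c, z = a + r * c.
Proof.
move=> sP Pe Px immP pureP; have [A AP] := issub_submodClosed sP.
have [eA xA] : e \in A /\ x \in A by split; apply/AP.
pose N : lmodType R := submod A; pose e' : N := Submod eA.
have immN : immediate e'.
  split=> [y|s p m hp /(congr1 val) /= h].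
    have [q [p [m [hp /AP mA yE]]]] := immP (val y) (iffLR (AP _) (valP y)).
    by exists q, p, (Submod mA); split=> //; apply: val_inj.
  by apply: pureP h => //; apply/AP/valP.
have [g ge] : exists g : {linear N -> R^o}, g e' = 1.
  apply: (immediate_functional hR immN); apply: flat_content_lp.
    exact/(torsion_flat_flat hR)/(immediate_torsion_flat immN).
  exact: (immediate_content hR immN).
exists (g (Submod xA)) => a r m /AP mA xE; exists (g (Submod mA)).
have -> : Submod xA = a *: e' + r *: (Submod mA : N) by apply: val_inj.
by rewrite linearD !linearZ ge; congr (_ + _); apply: mulr1.
Qed.

(* In E^2, with R embedded by e2 = (e, 0) and a formal solution x = (0, e), the
   submodule P generated by e2 and all (x - a e2) / r, for (a, r) in S, is an
   immediate extension of R e2 unless S is already solvable. *)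
Lemma solvable_regular (S : set (R * R)) :
  (forall p, S p -> regular p.2) -> consistent S -> solvable S.
Proof.
move=> regS cS; have [E [e [injE e_ann essE]]] := injective_hull hR.
have [[p0 Sp0]|S0] := pselect (exists p, S p); last first.
  by exists 0 => p Sp; case: S0; exists p.
apply: contrapT => nosol.
(* The two equations state, without division, that [y = l e2 + m (x - p.1 e2) / p.2]. *)
pose P : set (E * E)%type := [set y | exists p l m,
  [/\ S p, p.2 *: y.2 = m *: e & y.1 + p.1 *: y.2 = l *: e]].
pose e2 : (E * E)%type := (e, 0).
have finer p q t c l m (y : (E * E)%type) : q.2 = t * p.2 -> q.1 = p.1 + p.2 * c ->
    p.2 *: y.2 = m *: e -> y.1 + p.1 *: y.2 = l *: e ->
    q.2 *: y.2 = (t * m) *: e /\ y.1 + q.1 *: y.2 = (l + c * m) *: e.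
  move=> -> -> h1 h2; rewrite -!scalerA h1; split=> //.
  by rewrite [_ * c]mulrC !scalerDl addrA h2 -!scalerA h1.
have sP : issub P.
  split.
    by exists p0, 0, 0; split=> //=; rewrite ?scaler0 ?scale0r ?addr0.
  have lin p (r : R) y z l m l' m' : S p ->
      p.2 *: y.2 = m *: e -> y.1 + p.1 *: y.2 = l *: e ->
      p.2 *: z.2 = m' *: e -> z.1 + p.1 *: z.2 = l' *: e -> P (r *: y + z).
    move=> Sp h1 h2 h3 h4; exists p, (r * l + l'), (r * m + m'); split=> //=.
      by rewrite scalerDr scalerA mulrC -scalerA h1 h3 scalerDl scalerA.
    rewrite scalerDr addrACA scalerA mulrC -scalerA -scalerDr h2 h4.
    by rewrite scalerDl scalerA.
  move=> r y z [p [l [m [Sp h1 h2]]]] [q [l' [m' [Sq h3 h4]]]].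
  case: (divides_total hR q.2 p.2) => [[t qp]|[t pq]].
    have [c hc] := consistent_le cS Sq Sp qp.
    have [h5 h6] := finer _ _ _ _ _ _ y qp hc h1 h2.
    exact: lin Sq h5 h6 h3 h4.
  have [c hc] := consistent_le cS Sp Sq pq.
  have [h5 h6] := finer _ _ _ _ _ _ z pq hc h3 h4.
  exact: lin Sp h1 h2 h5 h6.
have division p : S p -> exists b, p.2 *: b = e.
  move=> /regS hp; have [|b bE] := @hull_divide R E injE p.2 e; last by exists b.
  by move=> t /hp ->; rewrite scale0r.
have Pm p b : S p -> p.2 *: b = e -> P (- (p.1 *: b), b).
  by move=> Sp h; exists p, 0, 1; rewrite /= h scale1r scale0r addNr.
have [||y [p [l [m [Sp h1 h2]]]]|s p m hp|z hz] := @immediate_solution (E * E)%type P e2 (0, e) sP.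
- by exists p0, 1, 0; rewrite /e2 /= !scaler0 addr0 scale0r scale1r.
- by exists p0, p0.1, p0.2; rewrite /= add0r.
- have [y20|y2N0] := pselect (y.2 = 0).
    exists l, 0, 0; split; [exact: nonunit0|exact: issub0 sP|].
    rewrite scale0r addr0; apply: injective_projections => /=.
      by rewrite -h2 y20 scaler0 addr0.
    by rewrite y20 scaler0.
  have mN0 : m <> 0.
    by move=> m0; apply: y2N0; apply: (hull_regular e_ann essE (regS _ Sp)); rewrite h1 m0 scale0r.
  (* Relative to the smaller modulus [q.2], the coefficients [l], [m] of [y] become [l + c m] and
     [t m]. If the second does not divide the first, it is a nonunit multiple of it, and [l + c m]
     factors out of [y]. *)
  have [q [t [c [Sq qp hc ndiv]]]] : exists q t c, [/\ S q, q.2 = t * p.2, q.1 = p.1 + p.2 * c &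
      ~ exists k, l + c * m = k * (t * m)].
    apply: contrapT => alldiv; apply: nosol.
    have {}alldiv q t c : S q -> q.2 = t * p.2 -> q.1 = p.1 + p.2 * c ->
        exists k, l + c * m = k * (t * m).
      by move=> *; apply: contrapT => ?; apply: alldiv; exists q, t, c.
    have [||v] := alldiv p 1 0 Sp; rewrite ?mul1r ?mulr0 ?mul0r ?addr0 // => lE.
    (* As [l = v m], [y] equals [m / p.2] times [x - (p.1 - p.2 v) e2], which suggests this
       solution. For a smaller modulus, [m] kills [v + c - k t], which is therefore a multiple of
       the regular [t]. *)
    exists (p.1 - p.2 * v) => q Sq.
    case: (divides_total hR q.2 p.2) => [[t qp]|[t pq]].
      have [c hc] := consistent_le cS Sq Sp qp.
      have [k hk] := alldiv q t c Sq qp hc.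
      have treg : regular t by apply: (@regular_factor _ p.2); rewrite mulrC -qp; apply: regS.
      have [|d hd] := @regular_divides R hR t (v + c - k * t) m treg mN0.
        have -> : m * (v + c - k * t) = (v * m + c * m) - k * (t * m) by ring.
        by rewrite -lE hk subrr.
      exists (- (k + d)); rewrite qp hc.
      have -> : v = (d + k) * t - c by rewrite mulrDl -hd; ring.
      by ring.
    have [c hc] := consistent_le cS Sp Sq pq.
    by exists (c - t * v); rewrite hc pq; ring.
  have [h3 h4] := finer _ _ _ _ _ _ y qp hc h1 h2.
  case: (strict_divides_total hR (l + c * m) (t * m)) => [[k hk]|[k hk tmE]].
    by case: ndiv; exists k.
  have [b bE] := division q Sq.
  have y2E : y.2 = (t * m) *: b.
    apply/eqP; rewrite -subr_eq0; apply/eqP/(hull_regular e_ann essE (regS _ Sq)).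
    by rewrite scalerBr h3 -bE !scalerA [q.2 * _]mulrC subrr.
  exists (l + c * m), k, (- (q.1 *: b), b); split=> //; first exact: Pm.
  apply: injective_projections => /=.
    apply/eqP; rewrite scalerN scalerBr -h4 y2E tmE eq_sym subr_eq; apply/eqP.
    by congr (_ + _); rewrite !scalerA; congr (_ *: _); ring.
  by rewrite add0r scalerA mulrC -tmE.
- move=> [q [l [_ [Sq _ h2]]]] /(congr1 (fun w => (w.1, w.2)))[/= h3 /esym h4].
  rewrite scaler0 in h4; apply: (@nakayama_ring R hR s p l hp).
  apply/eqP; rewrite -subr_eq0; apply/eqP/e_ann.
  rewrite scalerBl h3 mulrA -[(s * p * l) *: e]scalerA -h2 scalerDr.
  by rewrite [_ *: (q.1 *: _)]scalerA [_ * q.1]mulrC -[_ *: m.2]scalerA h4 scaler0 addr0 subrr.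
apply: nosol; exists z => p Sp; have [b bE] := division p Sp.
apply: hz (Pm p b Sp bE) _; apply: injective_projections => /=.
  by rewrite scalerN scalerA mulrC -scalerA bE subrr.
by rewrite scaler0 add0r.
Qed.

(* Either dividing by some r0 leaves a system with regular moduli, or the moduli
   shrink by zero-divisors arbitrarily far down. Then injectivity of the hull E
   gives x with (0 : r) (x - a e) = 0, so x - a e \in r E, for all (a, r) in S, and
   the gaps push both x and the quotients (x - a e) / r into R e + Z E. *)
Lemma all_solvable (S : set (R * R)) : consistent S -> solvable S.
Proof.
move=> cS; have [[p0 [Sp0 tail]]|gap] := pselect (exists p0, S p0 /\
    forall p, S p -> (exists t, p.2 = t * p0.2) -> exists t, regular t /\ p.2 = t * p0.2).
  have [r0|rN0] := pselect (p0.2 = 0).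
    exists p0.1 => p Sp; apply: (consistent_le (t := 0) cS Sp0 Sp).
    by rewrite r0 mul0r.
  (* The unknown is written [p0.1 + p0.2 z] and the congruences are divided by [p0.2]. Consistency
     survives: a discrepancy killed by the nonzero [p0.2] is a multiple of any regular modulus. *)
  have [|[c t] [d u] [/= tr hp] [/= ur hq]|z hz] := @solvable_regular
      [set q | regular q.2 /\ S (p0.1 + p0.2 * q.1, q.2 * p0.2)].
  - by move=> q [].
  - have [k [k' /= h]] := cS _ _ hp hq.
    have [|w hw] := @regular_divides R hR u (c + t * k - (d + u * k')) p0.2 ur rN0.
      have -> : p0.2 * (c + t * k - (d + u * k')) =
        (p0.1 + p0.2 * c + t * p0.2 * k) - (p0.1 + p0.2 * d + u * p0.2 * k') by ring.
      by rewrite h subrr.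
    exists k, (k' + w); apply/eqP; rewrite -subr_eq0; apply/eqP.
    have -> : c + t * k - (d + u * (k' + w)) = (c + t * k - (d + u * k')) - w * u by ring.
    by rewrite -hw subrr.
  exists (p0.1 + p0.2 * z) => p Sp.
  have [below|[t pE]] := divides_total hR p.2 p0.2.
    have [t [tr pE]] := tail p Sp below.
    have [c hc] := consistent_le cS Sp Sp0 pE.
    have [|k ->] := hz (c, t).
      by split=> //=; rewrite -hc -pE; case: p Sp {below pE hc}.
    by exists k; rewrite hc pE /=; ring.
  have [c ->] := consistent_le cS Sp0 Sp pE.
  by exists (c + t * z); rewrite pE; ring.
have {}gap p : S p -> exists q t, [/\ S q, q.2 = t * p.2 & ~ regular t].
  move=> Sp; apply: contrapT => h; apply: gap; exists p; split=> // q Sq [t qE].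
  by apply: contrapT => h'; apply: h; exists q, t; split=> // tr; apply: h'; exists t.
have [[p0 Sp0]|S0] := pselect (exists p, S p); last first.
  by exists 0 => p Sp; case: S0; exists p.
have [E [e [injE e_ann essE]]] := injective_hull hR.
have [|x hx] := injE [set y | exists p, [/\ S p, y.1 * p.2 = 0 & y.2 = (y.1 * p.1) *: e]].
  split; [split|].
  - by exists p0; split=> //=; rewrite ?mul0r ?scale0r.
  - have lin (r s s' : R) p : s * p.2 = 0 -> s' * p.2 = 0 ->
        (r * s + s') * p.2 = 0 /\
        r *: ((s * p.1) *: e) + (s' * p.1) *: e = ((r * s + s') * p.1) *: e.
      move=> h h'; split; first by rewrite mulrDl -mulrA h h' mulr0 addr0.
      by rewrite scalerA -scalerDl mulrDl mulrA.
    have same s p q t : S p -> S q -> q.2 = t * p.2 -> s * p.2 = 0 ->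
        s * q.2 = 0 /\ s * p.1 = s * q.1.
      move=> Sp Sq qE sp; have [c hc] := consistent_le cS Sq Sp qE.
      split; first by rewrite qE mulrCA sp mulr0.
      by rewrite hc mulrDr mulrA sp mul0r addr0.
    move=> r [s y] [s' y'] [p [Sp /= sp ->]] [q [Sq /= s'q ->]].
    case: (divides_total hR q.2 p.2) => [[t qE]|[t pE]].
      have [sq ->] := same s p q t Sp Sq qE sp.
      by exists q; have [h1 h2] := lin r s s' q sq s'q.
    have [s'p ->] := same s' q p t Sq Sp pE s'q.
    by exists p; have [h1 h2] := lin r s s' p sp s'p.
  - by move=> y [p [_ _ /= ->]]; rewrite mul0r scale0r.
(* A smaller modulus [q.2 = t p.2] with [t] a zero-divisor gives [x = q.1 e + q.2 y]; relative to
   [p] the quotient is [c e + t y], with [t y] in [Z E]. *)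
have approx p : S p -> exists2 y, zd_neighbourhood e y & x = p.1 *: e + p.2 *: y.
  move=> Sp; have [q [t [Sq qE tz]]] := gap p Sp.
  have [c hc] := consistent_le cS Sq Sp qE.
  have [|y yE] := @hull_divide R E injE q.2 (x - q.1 *: e).
    move=> s sq; rewrite scalerBr scalerA -(hx s ((s * q.1) *: e)) ?subrr //.
    by exists q.
  exists (c *: e + t *: y); first by exists c, (t *: y); split=> //; exists t, y.
  rewrite scalerDr !scalerA [p.2 * t]mulrC -qE -yE addrA -scalerDl -hc.
  by rewrite addrC subrK.
have sP := @zd_neighbourhood_sub R hR E e.
have Pe : zd_neighbourhood e e.
  by exists 1, 0; rewrite scale1r addr0; split=> //; exact: issub0 (@zd_multiple_sub R hR E).
have Px : zd_neighbourhood e x.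
  have [y Py ->] := approx p0 Sp0.
  exact: (issubD sP (issubZ sP _ Pe) (issubZ sP _ Py)).
have [||z hz] := immediate_solution sP Pe Px.
- exact: zd_neighbourhood_immediate.
- exact: zd_neighbourhood_pure.
by exists z => p Sp; have [y Py xE] := approx p Sp; apply: hz xE.
Qed.

Lemma maximal_of_flat_content : maximal_ring R.
Proof. exact/maximal_of_solvable/all_solvable. Qed.

End Systems.

(** * Flat content modules and separability *)

Section Uniserial.
Variables (R : comNzRingType) (W : lmodType R).

Lemma uniserialP : uniserial W <->
  forall u v : W, (exists c, u = c *: v) \/ (exists c, v = c *: u).
Proof.
split=> [uW u v|h A B].
  have [[A hA] [B hB]] := (cyclic_submodule u, cyclic_submodule v).
  by case: (uW A B) => AB; [left|right]; [apply/hB/AB/hA|apply/hA/AB/hB]; exists 1; rewrite scale1r.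
have [|nAB] := pselect {subset A <= B}; first by left.
right=> v vB; apply: contrapT => vA; apply: nAB => u uA.
by case: (h u v) => [[c ->]|[c vE]]; [rewrite rpredZ|case: vA; rewrite vE rpredZ].
Qed.

End Uniserial.

Lemma uniserial_submodP (R : comNzRingType) (M : lmodType R) (U : submodClosed M) :
  uniserial (submod U) <-> forall u v, u \in U -> v \in U ->
    (exists c, u = c *: v) \/ (exists c, v = c *: u).
Proof.
split=> [/uniserialP h u v uU vU|h].
  by case: (h (Submod uU) (Submod vU)) => [[c /(congr1 val) /= ->]|[c /(congr1 val) /= ->]];
    [left|right]; exists c.
apply/uniserialP => u v.
by case: (h _ _ (valP u) (valP v)) => [[c uE]|[c vE]]; [left|right]; exists c; apply: val_inj.
Qed.

Lemma free_row (R : comNzRingType) (n : nat) : free_module ('rV[R]_n : lmodType R).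
Proof.
exists [set x | exists j, x = delta_mx 0 j]; split.
  move=> s c us sX s0 x xs; have [j xE] := sX x xs.
  have := congr1 (fun v : 'rV[R]_n => v 0 j) s0.
  rewrite summxE (bigD1_seq x) //= !mxE xE !mxE !eqxx mulr1 big_seq_cond big1 ?addr0 -?xE //.
  move=> y /andP[/sX[k ->] kj]; rewrite !mxE eqxx /=.
  by have [jk|] := eqVneq j k; [rewrite xE jk eqxx in kj|rewrite mulr0].
move=> y; exists [seq delta_mx 0 j | j <- enum 'I_n],
  (fun x => \sum_j y 0 j *+ (x == delta_mx 0 j)).
split; first by move=> x /mapP[j _ ->]; exists j.
rewrite big_map big_enum /= {1}[y]row_sum_delta; apply: eq_bigr => j _.
congr (_ *: _); rewrite (bigD1 j) //= eqxx big1 ?addr0 // => k kj.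
case: eqP => // /matrixP/(_ 0 k); rewrite !mxE !eqxx /= => /eqP.
by rewrite (negbTE kj) eq_sym oner_eq0.
Qed.

Section SinglyProjective.
Variables (R : comNzRingType) (hR : valuation_ring R).

(* Tensor the inclusion of R s in R with M: m (x) s = 0, and the pairing
   (m, r s) |-> r m with values in M / (0 : s) M shows m \in (0 : s) M. *)
Lemma flat_torsion_flat (M : lmodType R) : flat M -> torsion_flat M.
Proof.
move=> flatM s m sm.
have sP : issub [set x : M | exists t y, s * t = 0 /\ x = t *: y].
  split; first by exists 0, 0; rewrite mulr0 scaler0.
  move=> r _ _ [t [y [st ->]]] [t' [y' [st' ->]]].
  case: (divides_total hR t t') => [[c tE]|[c tE]].
    exists t', ((r * c) *: y + y'); split=> //.
    by rewrite tE scalerDr !scalerA; congr (_ *: _ + _); ring.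
  exists t, (r *: y + c *: y'); split=> //.
  by rewrite tE scalerDr !scalerA; congr (_ *: _ + _ *: _); ring.
pose p : {pred M} := fun x => `[< exists t y, s * t = 0 /\ x = t *: y >].
have pP : GRing.zmod_closed p.
  split=> [|x y /asboolP hx /asboolP hy]; apply/asboolP; first exact: issub0 sP.
  exact: (issubB sP hx hy).
pose I : zmodClosed M := HB.pack p (GRing.isZmodClosed.Build M p pP).
have [X [q [_ q0']]] := quotient_map I.
have q0 x : q x = 0 <-> exists t y, s * t = 0 /\ x = t *: y.
  by split=> [/q0'/asboolP|h]; last by apply/q0'/asboolP.
have [A hA] := cyclic_submodule (s : R^o).
have sA : (s : R^o) \in A by apply/hA; exists 1; rewrite scale1r.
have [c cE] := choice (fun a : submod A => iffLR (hA (val a)) (valP a)).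
have [T [t tP]] := tensor_product_exists M (submod A).
have [tB tBE] : exists b : {bilinear M -> R^o -> M}, forall m r, b m r = r *: m.
  apply: bilinear_pack; split=> [a|x] k u v.
    by rewrite /= scalerDr !scalerA mulrC.
  by rewrite /= scalerDl scalerA.
have tBP : is_tensor_product tB.
  move=> P b; have gP : linear (fun x => b x 1) by move=> k x y; rewrite linearPl.
  pose g0 x := b x 1.
  pose g : {linear M -> P} := HB.pack g0 (GRing.isLinear.Build R M P *:%R g0 gP).
  exists g; split=> [x a|g' hg' x].
    rewrite tBE /g /= /g0 linearZl_LR -linearZr_LR; congr (b x _); exact: mulr1.
  by rewrite /g /= /g0 -hg' tBE scale1r.
have [b bE] : exists b : {bilinear M -> submod A -> M}, forall m a, b m a = val a *: m.
  apply: bilinear_pack; split=> [a|x] k u v.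
    by rewrite /= scalerDr !scalerA mulrC.
  by rewrite /= scalerDl scalerA.
have [h [hE _]] := tP M b.
have tms : t m (Submod sA) = 0.
  apply: (flatM _ _ (val : {linear submod A -> R^o}) val_inj _ _ t tB tP tBP h).
    by move=> x a; rewrite hE bE tBE.
  by rewrite hE bE linear0.
pose P : lmodType R := dual (R^o : lmodType R) X.
have dP (x : M) (a : submod A) : (fun r : R^o => q (r *: (c a *: x))) \in @dual_pred R R^o X.
  by apply/asboolP => u v; rewrite scalerBl raddfB.
have qeq (u v : R) (x : M) : u * s = v * s -> q (u *: x) = q (v *: x).
  move=> uv; apply/eqP; rewrite -subr_eq0 -raddfB; apply/eqP/q0.
  by exists (u - v), x; rewrite scalerBl mulrC mulrBl uv subrr.
have cs a : c a * s = val a :> R by rewrite cE.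
have [d dE] : exists d : {bilinear M -> submod A -> P},
    forall m a (r : R^o), d m a r = q (r *: (c a *: m)).
  have [|d hd] := @bilinear_pack R M (submod A) P (fun (x : M) (a : submod A) => Dual (dP x a) : P).
    split=> [a|x] k u v; apply: dualP => r; rewrite dualDE dualZE /= -raddfD.
      rewrite !scalerDr !scalerA; congr (q (_ *: _ + _)).
      by rewrite mulrC mulrA.
    rewrite !scalerA -scalerDl; apply: qeq.
    rewrite mulrDl -!mulrA !cs /= mulrDr; congr (_ + _).
    exact: mulrCA.
  by exists d => x a r; rewrite hd.
have [g [gE _]] := tP P d.
have := gE m (Submod sA); rewrite tms linear0 => /(congr1 (fun F : P => F 1)).
rewrite dual0E dE scale1r (@qeq _ 1) ?mul1r; last by have /= := cE (Submod sA).
by rewrite scale1r => /esym/q0.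
Qed.

Definition cyclically_free (M : lmodType R) : Prop :=
  forall x : M, x = 0 \/ exists q w, x = q *: w /\ forall s, s *: w = 0 -> s = 0.

Lemma cyclically_free_singly_projective (M : lmodType R) :
  cyclically_free M -> singly_projective M.
Proof.
move=> cfM N [x0 Nx0]; exists ('rV[R]_1 : lmodType R).
have [w wE] : exists w : M, (forall x, x \in N -> exists a, x = a *: w) /\
    ((forall s, s *: w = 0 -> s = 0) \/ w = 0).
  have [x00|[q [w [x0E w_ann]]]] := cfM x0.
    by exists 0; split=> [x /Nx0[r ->]|]; [exists 0; rewrite x00 !scaler0|right].
  by exists w; split=> [x /Nx0[r ->]|]; [exists (r * q); rewrite x0E scalerA|left].
(* The map sends [a w] to [a]. The clause on [w = 0] keeps it single-valued when [x0 = 0] and [w]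
   was taken to be 0. *)
have [|||f hf] := @linear_of_rel R (submod N) 'rV[R]_1
    (fun n v => val n = v 0 0 *: w /\ (w = 0 -> v = 0)).
- move=> n; have [a nE] := wE.1 _ (valP n).
  have [w0|wN0] := pselect (w = 0).
    by exists 0; split=> //; rewrite nE w0 !scaler0.
  by exists (const_mx a); rewrite mxE.
- move=> r a v b u [/= -> hv] [/= -> hu]; rewrite !mxE scalerDl scalerA; split=> // w0.
  by rewrite hv // hu // scaler0 addr0.
- move=> v [/= /esym v0 hv]; case: wE.2 => [/(_ _ v0) v00|/hv //].
  by apply/matrixP => i j; rewrite !ord1 mxE.
have [|||g hg] := @linear_of_rel R 'rV[R]_1 M (fun v x => x = v 0 0 *: w).
- by move=> v; exists (v 0 0 *: w).
- by move=> r v x u y -> ->; rewrite !mxE scalerDl scalerA.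
- by move=> x; rewrite mxE scale0r.
exists f, g; split; first exact: free_row.
by move=> n; apply/hg; have [->] := iffRL (hf n _) erefl.
Qed.

Lemma singly_projective_divide (M : lmodType R) (x : M) : singly_projective M -> x <> 0 ->
  exists q w, x = q *: w /\ forall s, s *: x = 0 -> s * q = 0.
Proof.
move=> spM xN0; have [N hN] := cyclic_submodule x.
have [|F [f [g [freeF gf]]]] := spM N; first by exists x.
have xN : x \in N by apply/hN; exists 1; rewrite scale1r.
pose x' : submod N := Submod xN.
have [|q [v [h [fE hv]]]] := @free_primitive R hR F (f x') freeF.
  by move=> f0; apply: xN0; have := gf x'; rewrite f0 linear0.
exists q, (g v); split; first by rewrite -linearZ -fE gf.
move=> s sx; have /(congr1 h) : s *: f x' = 0.
  by rewrite -linearZ (_ : s *: x' = 0) ?linear0 //; apply: val_inj.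
by rewrite fE scalerA linearZ hv linear0 => <-; rewrite [RHS]mulr1.
Qed.

(** If [t = c q], then [c x = t w = 0], so [c q = 0] and [t = 0]. If [q = c t], then
    [x = c t w = 0], a contradiction. *)
Lemma singly_projective_ann (M : lmodType R) (x w : M) q : singly_projective M ->
  x <> 0 -> x = q *: w -> (forall s, s *: x = 0 -> s * q = 0) ->
  forall t, t *: w = 0 -> t = 0.
Proof.
move=> spM xN0 xE qann t tw; apply: contrapT => tN0.
have wN0 : w <> 0 by move=> w0; apply: xN0; rewrite xE w0 scaler0.
have [r [u [wE rann]]] := singly_projective_divide spM wN0.
have tr : t * r = 0 by apply: rann.
case: (divides_total hR t q) => [[c tE]|[c qE]].
  apply: tN0; rewrite tE; apply: qann.
  by rewrite xE wE !scalerA -tE tr scale0r.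
by apply: xN0; rewrite xE qE -scalerA tw scaler0.
Qed.

Section FlatContent.
Variables (M : lmodType R) (flatM : flat M) (contentM : content_module M).

(** Take [a] in the content of [x] with [x = a w]. If [x = a p y], then [a] lies in [R a p], so
    [a = 0] by Nakayama's lemma. *)
Lemma content_primitive (x : M) : x <> 0 -> exists a w, x = a *: w /\
  forall p y, nonunit p -> x <> (a * p) *: y.
Proof.
move=> xN0; have [//|[a [w [/contentP ax xE]]]] := in_mul_inv hR (contentM x).
exists a, w; split=> // p y hp xE'.
have [A hA] := cyclic_submodule (a * p : R^o).
have /ax/hA[c aE] : in_mul A x.
  by rewrite xE'; apply: in_mulZ; apply/hA; exists 1; rewrite scale1r.
apply: xN0; rewrite xE; suff -> : a = 0 by rewrite scale0r.
by apply: (@nakayama_ring R hR a p c hp); rewrite {1}aE -[_ *: _]/(c * (a * p)) mulrC mulrA.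
Qed.

(** If [s w = 0], flatness gives [w = t y] with [s t = 0]. For nonzero [s] this [t] is a nonunit,
    against primitivity. *)
Lemma primitive_ann (a : R) (w : M) : a *: w <> 0 ->
  (forall p y, nonunit p -> a *: w <> (a * p) *: y) -> forall s, s *: w = 0 -> s = 0.
Proof.
move=> awN0 prim s sw; have [t [y [st wE]]] := flat_torsion_flat flatM sw.
apply: contrapT => sN0; apply: (prim t y); last by rewrite wE scalerA.
exact: zero_divisor_nonunit sN0 st.
Qed.

Lemma flat_content_singly_projective : singly_projective M.
Proof.
apply: cyclically_free_singly_projective => x.
have [|xN0] := pselect (x = 0); [by left|right].
have [a [w [xE prim]]] := content_primitive xN0.
by exists a, w; split=> //; apply: (@primitive_ann a); rewrite -xE.
Qed.

Lemma separable_locally_projective : separable M -> locally_projective M.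
Proof.
move=> sepM N [n [g Ng]].
have [N' [gN' [K [disj dec]] [k [U [[N'E indep] uniU]]]]] :=
  sepM (range g) (finite_image _ (@finite_finset _ _)).
have full x : exists u z, [/\ forall i, u i \in U i, z \in K & x = \sum_i u i + z].
  have [y [z [/N'E[u [uU ->]] zK ->]]] := dec x.
  by exists u, z.
have uniq u z : (forall i, u i \in U i) -> z \in K -> \sum_i u i + z = 0 -> forall i, u i = 0.
  move=> uU zK uz; apply: indep => //; apply: disj; first by apply/N'E; exists u.
  rewrite -[X in X \in _](addrK z) uz sub0r.
  exact: (issubN (issub_mem K)).
have gens i : exists m, [/\ m \in U i, forall u, u \in U i -> exists c, u = c *: m &
    (forall s, s *: m = 0 -> s = 0) \/ m = 0].
  have [[x [xU xN0]]|U0] := pselect (exists x, x \in U i /\ x <> 0); last first.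
    exists 0; split; [exact: rpred0| |by right] => u uU; exists 0; rewrite scaler0.
    by apply: contrapT => uN0; apply: U0; exists u.
  have [a [w [xE prim]]] := content_primitive xN0.
  have [u [z [uU zK wE]]] := full w.
  have xE' : x = a *: u i.
    have hU j : a *: u j - (if j == i then x else 0) \in U j.
      apply: (issubB (issub_mem (U j))); first exact: rpredZ.
      by case: eqP => [->|_]; last exact: rpred0.
    have := uniq _ (a *: z) hU (issubZ (issub_mem K) a zK).
    rewrite sumrB -scaler_sumr -big_mkcond big_pred1_eq addrAC -scalerDr -wE -xE subrr.
    by move=> /(_ erefl i)/eqP; rewrite eqxx subr_eq0 => /eqP.
  exists (u i); split=> //; last first.
    by left; apply: (@primitive_ann a); rewrite -xE'.
  move=> v vU; have [//|[c uE]] := (uniserial_submodP _).1 (uniU i) v (u i) vU (uU i).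
  have [[b cb]|hc] := unit_or_nonunit c.
    by exists b; rewrite uE scalerA mulrC cb scale1r.
  by case: (prim c v hc); rewrite xE' uE scalerA.
have [m hm] := choice gens.
(* Coordinates along the zero summands are set to 0, so that [phi] is single-valued. *)
have [|||phi hphi] := @linear_of_rel R M 'rV[R]_k (fun x v => exists z, [/\ z \in K,
    x = \sum_i v 0 i *: m i + z & forall i, m i = 0 -> v 0 i = 0]).
- move=> x; have [u [z [uU zK ->]]] := full x.
  have : forall i, exists c, u i = c *: m i /\ (m i = 0 -> c = 0).
    move=> i; have [_ gen _] := hm i; have [c uE] := gen _ (uU i).
    have [mi0|miN0] := pselect (m i = 0); last by exists c.
    by exists 0; rewrite uE mi0 !scaler0.
  move=> /choice[c hc]; exists (\row_i c i), z; split=> //.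
    by congr (_ + _); apply: eq_bigr => i _; rewrite mxE; have [] := hc i.
  by move=> i; rewrite mxE; have [] := hc i.
- move=> r _ v _ v' [z [zK -> hv]] [z' [zK' -> hv']]; exists (r *: z + z'); split.
  + by rewrite rpredD ?rpredZ.
  + rewrite scalerDr addrACA scaler_sumr -big_split /=; congr (_ + _).
    by apply: eq_bigr => i _; rewrite !mxE scalerDl scalerA.
  + by move=> i mi0; rewrite !mxE hv // hv' // mulr0 addr0.
- move=> v [z [zK /esym vz hv]]; apply/matrixP => i j; rewrite ord1 mxE.
  have := uniq (fun i => v 0 i *: m i) z _ zK vz j.
  have [mU _ [ann|/hv //]] := hm j.
  by move=> h; apply/ann/h => i'; have [mU' _ _] := hm i'; apply: rpredZ.
have [|||pi hpi] := @linear_of_rel R 'rV[R]_k M (fun v x => x = \sum_i v 0 i *: m i).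
- by move=> v; exists (\sum_i v 0 i *: m i).
- move=> r v x v' x' -> ->; rewrite scaler_sumr -big_split /=.
  by apply: eq_bigr => i _; rewrite !mxE scalerDl scalerA.
- by move=> x ->; rewrite big1 // => i _; rewrite mxE scale0r.
exists ('rV[R]_k : lmodType R), phi, pi; split; first exact: free_row.
move=> x /Ng[c xE]; have [z [zK xE' _]] := iffRL (hphi x _) erefl.
apply/hpi; rewrite {1}xE' (_ : z = 0) ?addr0 //; apply: disj => //.
have -> : z = x - \sum_i phi x 0 i *: m i by rewrite {1}xE' addrC addKr.
apply: (issubB (issub_mem N')).
  rewrite xE; apply: (issub_sum (issub_mem N')) => i /=.
  by apply: rpredZ; apply: gN'; exists i.
apply/N'E; exists (fun i => phi x 0 i *: m i); split=> // i.
by have [mU _ _] := hm i; apply: rpredZ.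
Qed.

End FlatContent.
End SinglyProjective.

(** * Modules over maximal valuation rings *)

Lemma finite_least (I : Type) (J : set I) (le : I -> I -> Prop) :
  (forall i j, le i j \/ le j i) -> (forall i j k, le i j -> le j k -> le i k) ->
  finite_set J -> J !=set0 -> exists2 j, J j & forall i, J i -> le j i.
Proof.
elim/Peq: I => I in J le *; move=> tot trans /finite_seqP[s ->].
elim: s => [[x]//|i s ih _].
have [s0|sN0] := pselect ([set` s] !=set0); last first.
  exists i => [|j]; rewrite /= ?mem_head // inE => /predU1P[->|js]; first by case: (tot i i).
  by case: sN0; exists j.
have [k ks hk] := ih s0.
case: (tot i k) => ik.
  exists i; rewrite /= ?mem_head // => j; rewrite inE => /predU1P[->|js]; first by case: (tot i i).
  by apply: trans ik _; apply: hk.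
by exists k => [|j]; rewrite /= inE ?ks ?orbT // => /predU1P[->|/hk].
Qed.

Section MaximalRings.
Variables (R : comNzRingType) (hR : valuation_ring R) (maxR : maximal_ring R).
Variable M : lmodType R.

Definition uniserial_on (U : set M) : Prop :=
  forall u v, U u -> U v -> (exists c, u = c *: v) \/ (exists c, v = c *: u).

Lemma uniserial_on_sub (U L L' : set M) : uniserial_on U -> issub L -> issub L' ->
  L `<=` U -> L' `<=` U -> L `<=` L' \/ L' `<=` L.
Proof.
move=> uU sL sL' LU LU'; have [|nLL'] := pselect (L `<=` L'); first by left.
right=> v Lv; apply: contrapT => nLv; apply: nLL' => u Lu.
by case: (uU u v (LU _ Lu) (LU' _ Lv)) => [[c ->]|[c vE]];
  [apply: issubZ|case: nLv; rewrite vE; apply: issubZ].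
Qed.

(* If L i0 <> U, then all c i + L i may be intersected with c i0 + L i0, which lies
   in a cyclic submodule R v; pulled back to R, they become cosets of ideals. *)
Lemma linear_compactness (U : set M) (I : Type) (c : I -> M) (L : I -> set M) :
  issub U -> uniserial_on U -> (forall i, U (c i)) ->
  (forall i, issub (L i)) -> (forall i, L i `<=` U) ->
  (forall i j, exists u, L i (u - c i) /\ L j (u - c j)) ->
  exists2 u, U u & forall i, L i (u - c i).
Proof.
move=> sU uU cU sL LU meet.
have [[i0 [w [Uw nLw]]]|allU] := pselect (exists i w, U w /\ ~ L i w); last first.
  exists 0 => [|i]; first exact: issub0.
  apply: contrapT => h; apply: allU; exists i, (0 - c i); split=> //.
  by rewrite sub0r; apply: issubN.
have [v [Uv [al wE] [be cE]]] : exists v, [/\ U v, exists a, w = a *: v & exists b, c i0 = b *: v].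
  by case: (uU w (c i0) Uw (cU i0)) => [[d dE]|[d dE]]; [exists (c i0)|exists w];
    split=> //; (try by exists d); exists 1; rewrite scale1r.
have Lv l : L i0 l -> exists a, l = a *: v.
  move=> Ll; case: (uU l w (LU _ _ Ll) Uw) => [[d ->]|[d wE']].
    by exists (d * al); rewrite wE scalerA.
  by case: nLw; rewrite wE'; apply: issubZ.
have /choice[a ha] : forall i, exists a, L i (a *: v - c i) /\ L i0 (a *: v - c i0).
  move=> i; have [u [Lu L0u]] := meet i i0; have [d dE] := Lv _ L0u.
  exists (d + be); suff <- : u = (d + be) *: v by [].
  by rewrite scalerDl -dE -cE subrK.
have /choice[A hA] : forall i, exists A : ideal R,
    forall r, r \in A <-> L i (r *: v) /\ L i0 (r *: v).
  move=> i; apply: (@issub_submodClosed R R^o [set r | L i (r *: v) /\ L i0 (r *: v)]).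
  split; first by rewrite /= scale0r; split; apply: issub0.
  by move=> r x y /= [h1 h2] [h3 h4]; rewrite scalerDl -scalerA; split; apply: (sL _).2.
have [J finJ|z hz] := @maxR I a A.
  have [[j Jj]|J0] := pselect (J !=set0); last first.
    by exists 0 => i Ji; case: J0; exists i.
  (* The point [a k] attached to the least [L k] serves for all of [J]: cosets [i] and [k] meet, and
     [L k] lies in [L i]. *)
  have [|i k l ik kl||k Jk hk] := @finite_least I J (fun i j => L i `<=` L j) _ _ finJ.
  - by move=> i k; apply: (uniserial_on_sub uU).
  - exact: subset_trans ik kl.
  - by exists j.
  exists (a k) => i Ji; apply/hA; rewrite scalerBl; split.
    have [u [ui uk]] := meet i k.
    have -> : a k *: v - a i *: v =
        (a k *: v - c k) - (u - c k) + (u - c i) - (a i *: v - c i).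
      by rewrite !opprB !addrA !subrK.
    apply: (issubB (sL i)); last by have [] := ha i.
    apply: (issubD (sL i)) => //; apply: hk => //.
    by apply: (issubB (sL k)) => //; have [] := ha k.
  have -> : a k *: v - a i *: v = (a k *: v - c i0) - (a i *: v - c i0).
    by rewrite opprB addrA subrK.
  by apply: (issubB (sL i0)); [have [] := ha k|have [] := ha i].
exists (z *: v) => [|i]; first exact: issubZ.
have [/hA[h _] _] := (hz i Logic.I, Logic.I).
have -> : z *: v - c i = (z - a i) *: v + (a i *: v - c i) by rewrite scalerBl addrA subrK.
by apply: (issubD (sL i)) => //; have [] := ha i.
Qed.

(* [pure_mod U] holds of K iff U meets K trivially and embeds in M / K as a
   (relatively divisible, hence) pure submodule. *)
Definition pure_mod (U : set M) : set M :=
  [set k | forall u r m, U u -> u = k + r *: m -> exists2 v, U v & u = r *: v].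

(* For K maximal, c satisfies [cond s t] when s (x - c) \in K + s t M; by linear
   compactness some u0 in U is congruent to all such c, and then K + R (x - u0)
   still lies in [pure_mod U], so that x - u0 \in K. *)
Lemma pure_complement (U N : set M) : issub U -> uniserial_on U ->
  issub N -> N `<=` pure_mod U ->
  exists K : set M, [/\ issub K, N `<=` K, forall x, U x -> K x -> x = 0 &
    forall x, exists u k, [/\ U u, K k & x = u + k]].
Proof.
move=> sU uU sN NU; have [K [sK NK KU Kmax]] := max_sub sN NU.
exists K; split=> // [x Ux Kx|x].
  have [|v _ ->] := KU x Kx x 0 0 Ux; last by rewrite scale0r.
  by rewrite scale0r addr0.
pose cond s t c := U c /\ exists k m, K k /\ s *: (x - c) = k + (s * t) *: m.
pose I := {p : R * R * M | cond p.1.1 p.1.2 p.2}.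
(* This is the submodule [t U + (0 :_U s)]; [cond s t] determines [c] only modulo it. *)
pose cong (s t : R) : set M := [set u | U u /\ exists2 v, U v & s *: (u - t *: v) = 0].
pose L (i : I) := cong (sval i).1.1 (sval i).1.2.
have meet (s1 t1 s2 t2 d : R) c1 c2 : cond s1 t1 c1 -> cond s2 t2 c2 -> s2 = d * s1 ->
    exists u, cong s1 t1 (u - c1) /\ cong s2 t2 (u - c2).
  move=> [Uc1 [k1 [m1 [Kk1 h1]]]] [Uc2 [k2 [m2 [Kk2 h2]]]] sE.
  have {}h1 : s2 *: (x - c1) = d *: k1 + (s2 * t1) *: m1.
    by rewrite sE -scalerA h1 scalerDr scalerA mulrA.
  (* Let [t] be the one of [t1], [t2] dividing the other. Purity modulo [K] gives
     [s2 (c1 - c2) = s2 t v] with [v] in [U]; the common point is [c1] if [t = t2], and [c1 - t1 v]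
     if [t = t1]. *)
  have diff : s2 *: (c1 - c2) = (k2 - d *: k1) + s2 *: (t2 *: m2 - t1 *: m1).
    have -> : c1 - c2 = (x - c2) - (x - c1) by rewrite opprB [RHS]addrC addrA subrK.
    by rewrite scalerBr h2 h1 scalerBr !scalerA opprD addrACA.
  have Kk : K (k2 - d *: k1) by apply: (issubB sK) => //; apply: issubZ.
  have U0 : U 0 by apply: issub0.
  have Uc : U (s2 *: (c1 - c2)) by apply/(issubZ sU)/(issubB sU).
  case: (divides_total hR t1 t2) => [[f tE]|[f tE]].
    have [|v Uv h] := KU _ Kk _ (s2 * t2) (m2 - f *: m1) Uc.
      rewrite diff; congr (_ + _); rewrite -scalerA; congr (_ *: _).
      by rewrite scalerBr scalerA [t2 * f]mulrC -tE.
    exists c1; rewrite subrr; split; split=> //.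
      by exists 0; rewrite ?scaler0 ?subrr ?scaler0.
      exact: (issubB sU).
    by exists v => //; rewrite scalerBr h scalerA subrr.
  have [|v Uv h] := KU _ Kk _ (s2 * t1) (f *: m2 - m1) Uc.
    rewrite diff; congr (_ + _); rewrite -scalerA; congr (_ *: _).
    by rewrite scalerBr scalerA [t1 * f]mulrC -tE.
  have Utv : U (t1 *: v) by apply: issubZ.
  exists (c1 - t1 *: v); split; split.
  - by rewrite addrAC subrr sub0r; apply: issubN.
  - exists (- v); first exact: issubN.
    by rewrite scalerN opprK [c1 - _ - c1]addrAC subrr sub0r addNr scaler0.
  - by apply: (issubB sU) => //; apply: (issubB sU).
  - by exists 0 => //; rewrite scaler0 subr0 addrAC scalerBr h -scalerA subrr.
have [|||i j|u0 Uu0 hu0] := @linear_compactness U I (fun i => (sval i).2) L sU uU.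
- by move=> [[[s t] c] []].
- move=> i; split; first by split; [exact: issub0|exists 0; rewrite ?scaler0 ?subrr ?scaler0 //; exact: issub0].
  move=> r u v [Uu [u' Uu' hu]] [Uv [v' Uv' hv]]; split; first exact: sU.2.
  exists (r *: u' + v'); first exact: sU.2.
  set s := (sval i).1.1 in hu hv *; set t := (sval i).1.2 in hu hv *.
  have -> : r *: u + v - t *: (r *: u' + v') = r *: (u - t *: u') + (v - t *: v').
    by rewrite scalerBr scalerDr opprD addrACA !scalerA [t * r]mulrC.
  by rewrite scalerDr hv addr0 scalerA mulrC -scalerA hu scaler0.
- by move=> i u [].
- case: i j => [[[s1 t1] c1] /= h1] [[[s2 t2] c2] /= h2]; rewrite /L /=.
  case: (divides_total hR s2 s1) => [[d sE]|[d sE]]; first exact: meet h1 h2 sE.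
  by have [u [hu1 hu2]] := meet _ _ _ _ _ _ _ h2 h1 sE; exists u.
exists u0, (x - u0); split=> //; last by rewrite [RHS]addrC subrK.
apply: Kmax => s k Kk u r m Uu uE.
case: (divides_total hR s r) => [[d sE]|[d rE]].
  apply: (KU k Kk u r (d *: (x - u0) + m) Uu).
  by rewrite uE sE [r *: (_ + m)]scalerDr scalerA [r * d]mulrC addrA.
(* Now [r = d s], and [c'] is divisible by [s] modulo [K], so [c' = s c] with [c] in [U]. Then
   [cond s d c] holds, and the choice of [u0] puts [u = s (c - u0)] in [s d U = r U]. *)
pose c' := u + s *: u0.
have c'E : c' = k + s *: (x + d *: m).
  rewrite /c' uE scalerBr [s *: (x + _)]scalerDr scalerA [s * d]mulrC -rE.
  by rewrite addrAC !addrA subrK.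
have Uc' : U c' by apply: (issubD sU) => //; apply: issubZ.
have [c Uc hc] := KU k Kk c' s (x + d *: m) Uc' c'E.
have hcond : cond s d c.
  split=> //; exists (- k), (- m); split; first exact: issubN.
  by rewrite scalerBr -hc c'E scalerDr scalerA scalerN !opprD addrCA addNKr.
have [_ [v Uv]] := hu0 (exist _ (s, d, c) hcond); rewrite /= => h.
exists (- v); first exact: issubN.
have -> : u = c' - s *: u0 by rewrite /c' addrK.
apply/eqP; rewrite hc rE mulrC scalerN -scalerA -addr_eq0 -!scalerBr -scalerDr.
by rewrite -[_ + _]opprK scalerN !opprD !opprK [- c + _]addrC h oppr0.
Qed.

(** * Pure uniserial closure of an element with zero annihilator *)

Section PureClosure.
Variables (K : set M) (sK : issub K) (y : M) (Ky : K y).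
Hypothesis y_ann : forall s, s *: y = 0 -> s = 0.
Hypothesis cfK : forall x, K x -> x = 0 \/
  exists q w, [/\ K w, x = q *: w & forall s, s *: w = 0 -> s = 0].

Definition regular_closure : set M :=
  [set z | K z /\ exists s t, regular s /\ s *: z = t *: y].

Lemma regular_torsion r z : regular r -> K z -> r *: z = 0 -> z = 0.
Proof.
move=> hr /cfK[//|[q [w [_ -> w_ann]]]]; rewrite scalerA => /w_ann.
by rewrite mulrC => /hr ->; rewrite scale0r.
Qed.

Lemma regular1 : regular (1 : R).
Proof. by move=> t; rewrite mulr1. Qed.

Lemma regular_closure_mem : regular_closure y.
Proof. by split=> //; exists 1, 1; split=> //; apply: regular1. Qed.

Lemma regular_closure_sub : issub regular_closure.
Proof.
split; first by split; [exact: issub0|exists 1, 0; rewrite scaler0 scale0r; split=> //; exact: regular1].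
move=> r a b [Ka [s [t [hs hsa]]]] [Kb [s' [t' [hs' hsb]]]]; split; first exact: sK.2.
exists (s * s'), (r * s' * t + s * t'); split; first exact: regularM.
rewrite scalerDr scalerDl scalerA -[_ *: b]scalerA hsb scalerA; congr (_ + _).
have -> : s * s' * r = r * s' * s by ring.
by rewrite -!scalerA hsa.
Qed.

(** Elements behave like fractions [(t / s) y]: compare the cross products [s' t] and [s t'], then
    cancel the regular factor [s s']. *)
Lemma regular_closure_uniserial : uniserial_on regular_closure.
Proof.
have div u v s s' t t' c : K u -> K v -> regular s -> regular s' ->
    s *: u = t *: y -> s' *: v = t' *: y -> s' * t = c * (s * t') -> u = c *: v.
  move=> Ku Kv hs hs' hu hv h; apply/eqP; rewrite -subr_eq0; apply/eqP.
  apply: (regular_torsion (regularM hs hs')); first by apply: (issubB sK) => //; apply: issubZ.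
  rewrite scalerBr mulrC -scalerA hu scalerA h [s' * s]mulrC scalerA.
  have -> : s * s' * c = c * s * s' by ring.
  by rewrite -[_ *: v]scalerA hv scalerA mulrA subrr.
move=> u v [Ku [s [t [hs hu]]]] [Kv [s' [t' [hs' hv]]]].
case: (divides_total hR (s' * t) (s * t')) => [[c h]|[c h]]; [left|right]; exists c.
  exact: div hs hs' hu hv h.
exact: div hs' hs hv hu h.
Qed.

(** From [s u = t y] with [s] regular, either [t = c s] and [u = c y], or [s = c t] and [c u = y];
    in the latter case [u] inherits the zero annihilator of [y]. *)
Lemma regular_closure_free u : regular_closure u -> u = 0 \/ exists c w,
  [/\ regular_closure w, u = c *: w & forall s, s *: w = 0 -> s = 0].
Proof.
move=> [Ku [s [t [hs hu]]]].
case: (divides_total hR t s) => [[c tE]|[c sE]]; right.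
  exists c, y; split=> //; first exact: regular_closure_mem.
  apply/eqP; rewrite -subr_eq0; apply/eqP/(regular_torsion hs).
    by apply: (issubB sK) => //; apply: issubZ.
  by rewrite scalerBr hu tE scalerA mulrC subrr.
exists 1, u; rewrite scale1r; split=> //; first by split=> //; exists s, t.
have yE : c *: u = y.
  apply/eqP; rewrite -subr_eq0; apply/eqP/(@regular_torsion t).
  - by apply: (@regular_factor _ c); rewrite -sE.
  - by apply: (issubB sK) => //; apply: issubZ.
  - by rewrite scalerBr scalerA mulrC -sE hu subrr.
by move=> a au; apply: y_ann; rewrite -yE scalerA mulrC -scalerA au scaler0.
Qed.

(** Write [u = c w] with [w] of zero annihilator. In the main case [r = d c], so [c] kills [w - d m]
    and [d] is regular. Then [w - d m = q v] with [c q = 0], hence [d] divides [q], and [w] is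
    divisible by [d] within the closure. *)
Lemma regular_closure_pure u r m : regular_closure u -> K m -> u = r *: m ->
  exists2 v, regular_closure v & u = r *: v.
Proof.
move=> Uu Km uE; have [u0|uN0] := pselect (u = 0).
  by exists 0; [exact: issub0 regular_closure_sub|rewrite scaler0].
have [//|[c [w [Uw uE' w_ann]]]] := regular_closure_free Uu.
case: (divides_total hR c r) => [[d cE]|[d rE]].
  by exists (d *: w); [exact: issubZ regular_closure_sub _ _ Uw|rewrite scalerA mulrC -cE].
have Kw : K w by case: Uw.
have cz : c *: (w - d *: m) = 0 by rewrite scalerBr -uE' uE rE scalerA mulrC subrr.
have Kz : K (w - d *: m) by apply: (issubB sK) => //; apply: issubZ.
have hd : regular d.
  move=> e ed; apply: contrapT => eN0.
  have ew : e *: w = e *: (w - d *: m) by rewrite scalerBr scalerA ed scale0r subr0.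
  case: (divides_total hR e c) => [[f eE]|[f cE]].
    by apply: eN0; apply: w_ann; rewrite ew eE -scalerA cz scaler0.
  by apply: uN0; rewrite uE rE cE [f * e]mulrC mulrA [d * e]mulrC ed mul0r scale0r.
have [q [v [Kv zE cq]]] : exists q v, [/\ K v, w - d *: m = q *: v & c * q = 0].
  case: (cfK Kz) => [z0|[q [v [Kv zE v_ann]]]].
    by exists 0, 0; rewrite z0 scaler0 mulr0; split=> //; apply: issub0.
  by exists q, v; split=> //; apply: v_ann; rewrite -scalerA -zE.
case: (divides_total hR q d) => [[f qE]|[f dE]]; last first.
  by case: uN0; rewrite uE rE dE -mulrA [q * c]mulrC cq mulr0 scale0r.
have wE : w = d *: (m + f *: v).
  by rewrite scalerDr scalerA [d * f]mulrC -qE -zE addrC subrK.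
exists (m + f *: v); last by rewrite uE' wE scalerA [c * d]mulrC -rE.
split; first by apply: (issubD sK) => //; apply: issubZ.
have [_ [s [t [hs hw]]]] := Uw; exists (s * d), t; split; first exact: regularM.
by rewrite -scalerA -wE.
Qed.

End PureClosure.

Definition decomposition (n : nat) (U : 'I_n -> submodClosed M) (K : set M) : Prop :=
  [/\ issub K,
    forall x, exists u k, [/\ forall i, u i \in U i, K k & x = \sum_i u i + k],
    forall u k, (forall i, u i \in U i) -> K k -> \sum_i u i + k = 0 -> forall i, u i = 0 &
    forall i, uniserial (submod (U i))].

(** By induction on [s]: the component in [K] of a new element lies in the pure closure [V] of some
    [w] in [K]. A complement [K'] of [V] containing the summands found so far yields the new
    remainder, the intersection of [K] and [K']. *)
Lemma decomposition_seq (s : seq M) : singly_projective M ->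
  exists n (U : 'I_n -> submodClosed M) K, decomposition U K /\
    forall x, x \in s -> exists u, (forall i, u i \in U i) /\ x = \sum_i u i.
Proof.
move=> spM; elim: s => [|x s [n [U [K [[sK dec indep uniU] hs]]]]].
  have [N _] := cyclic_submodule (0 : M).
  exists 0, (fun=> N), setT; split=> //; split.
  - by split.
  - by move=> x; exists (fun=> 0), x; rewrite big_ord0 add0r; split=> // -[].
  - by move=> u k _ _ _ [].
  - by case.
have [u [k [uU Kk xE]]] := dec x.
have [k0|kN0] := pselect (k = 0).
  exists n, U, K; split=> // z; rewrite inE => /predU1P[->|/hs //].
  by exists u; rewrite xE k0 addr0.
pose N : set M := [set z | exists u, (forall i, u i \in U i) /\ z = \sum_i u i].
have sN : issub N.
  split; first by exists (fun=> 0); split=> [i|]; [exact: rpred0|rewrite big1].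
  move=> r _ _ [a [aU ->]] [b [bU ->]]; exists (fun i => r *: a i + b i).
  by split=> [i|]; [rewrite rpredD ?rpredZ|rewrite big_split scaler_sumr].
have NK z : N z -> K z -> z = 0.
  move=> [a [aU zE]] Kz; rewrite zE big1 // => i _.
  by apply: (indep a (- z)) => //; [exact: issubN|rewrite zE subrr].
have divK z : K z -> z = 0 \/ exists q w, [/\ K w, z = q *: w & forall s, s *: w = 0 -> s = 0].
  move=> Kz; have [|zN0] := pselect (z = 0); [by left|right].
  have [q [w [zE qann]]] := singly_projective_divide hR spM zN0.
  have [a [w' [aU Kw' wE]]] := dec w.
  have zE' : z = q *: w'.
    apply/eqP; rewrite -subr_eq0; apply/eqP/NK; last by apply: (issubB sK) => //; apply: issubZ.
    by rewrite zE wE scalerDr addrK; apply: (issubZ sN); exists a.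
  by exists q, w'; split=> //; apply: (singly_projective_ann hR spM zN0 zE' qann).
have [//|[q [w [Kw kE w_ann]]]] := divK k Kk.
pose V := regular_closure K w.
have sV : issub V by apply: regular_closure_sub.
have VK z : V z -> K z by case.
have uV : uniserial_on V by apply: regular_closure_uniserial divK.
(* Modulo [N], the element [m] may be replaced by its component in [K], where [V] is pure. *)
have NV : N `<=` pure_mod V.
  move=> z Nz v r m Vv vE; have [a [m' [aU Km' mE]]] := dec m.
  apply: (regular_closure_pure sK Kw w_ann divK Vv Km').
  apply/eqP; rewrite -subr_eq0; apply/eqP/NK.
    rewrite vE mE scalerDr addrA addrK.
    by apply: (issubD sN) => //; apply: (issubZ sN); exists a.
  by apply: (issubB sK); [exact: VK|exact: issubZ].
have [K' [sK' NK' VK' sum]] := pure_complement sV uV sN NV.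
have [W hW] := issub_submodClosed sV.
pose ext T (t : T) (f : 'I_n -> T) (i : 'I_n.+1) := oapp f t (unlift ord0 i).
have ext0 T (t : T) f : ext T t f ord0 = t by rewrite /ext unlift_none.
have extS T (t : T) f i : ext T t f (lift ord0 i) = f i by rewrite /ext liftK.
have extU v a : V v -> (forall i, a i \in U i) -> forall i, ext M v a i \in ext _ W U i.
  move=> Vv aU i; case: (unliftP ord0 i) => [j ->|->]; rewrite ?ext0 ?extS //.
  exact/hW.
have ext_sum v a : \sum_i ext M v a i = v + \sum_i a i.
  by rewrite big_ord_recl ext0; congr (_ + _); apply: eq_bigr => i _; rewrite extS.
exists n.+1, (ext _ W U), (K `&` K'); split; [split|].
- split; first by split; apply: issub0.
  by move=> r y z [Ky K'y] [Kz K'z]; split; [apply: sK.2|apply: sK'.2].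
- move=> z; have [a [b [aU Kb ->]]] := dec z.
  have [v [c [Vv K'c bE]]] := sum b.
  exists (ext M v a), c; split; first exact: extU.
    split=> //; have -> : c = b - v by rewrite bE addrC addKr.
    by apply: (issubB sK) => //; apply: VK.
  by rewrite ext_sum bE addrCA addrA.
- move=> a c aU [Kc K'c]; rewrite big_ord_recl => ac.
  have Va : V (a ord0) by have := aU ord0; rewrite ext0 => /hW.
  have aU' i : a (lift ord0 i) \in U i by have := aU (lift ord0 i); rewrite extS.
  have aS i : a (lift ord0 i) = 0.
    apply: (indep (fun i => a (lift ord0 i)) (a ord0 + c)) => //.
      by apply: (issubD sK) => //; apply: VK.
    by rewrite addrCA addrA.
  move=> i; case: (unliftP ord0 i) => [j ->|->] //; apply: VK' => //.
  move: ac; rewrite big1 // addr0 => /eqP; rewrite addr_eq0 => /eqP ->.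
  exact: issubN.
- move=> i; case: (unliftP ord0 i) => [j ->|->]; rewrite ?ext0 ?extS //.
  by apply/uniserial_submodP => y z /hW Vy /hW Vz; apply: uV.
- move=> z; rewrite inE => /predU1P[->|/hs[a [aU ->]]].
    exists (ext M k u); rewrite ext_sum addrC; split=> //; apply: extU => //.
    by rewrite kE; apply/(issubZ sV)/regular_closure_mem.
  exists (ext M 0 a); rewrite ext_sum add0r; split=> //; apply: extU => //.
  exact: issub0.
Qed.

Lemma singly_projective_separable : singly_projective M -> separable M.
Proof.
move=> spM S /finite_seqP[s ->].
have [n [U [K [[sK dec indep uniU] hs]]]] := decomposition_seq s spM.
have [N hN] : exists N : submodClosed M, forall x,
    x \in N <-> exists u, (forall i, u i \in U i) /\ x = \sum_i u i.
  apply: (@issub_submodClosed R M [set x | exists u, (forall i, u i \in U i) /\ x = \sum_i u i]).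
  split; first by exists (fun=> 0); split=> [i|]; [exact: rpred0|rewrite big1].
  move=> r _ _ [a [aU ->]] [b [bU ->]]; exists (fun i => r *: a i + b i).
  by split=> [i|]; [rewrite rpredD ?rpredZ|rewrite big_split scaler_sumr].
have [K' hK'] := issub_submodClosed sK.
exists N; split.
- by move=> x /hs hx; apply/hN.
- exists K'; split=> [x /hN[u [uU xE]] /hK' Kx|x].
    rewrite xE big1 // => i _; apply: (indep u (- x)) => //; first exact: issubN.
    by rewrite xE subrr.
  have [u [k [uU Kk ->]]] := dec x.
  by exists (\sum_i u i), k; split=> //; [apply/hN; exists u|apply/hK'].
- exists n, U; split=> //; split=> // u uU u0.
  by apply: (indep u 0) => //; [exact: issub0|rewrite addr0].
Qed.

End MaximalRings.

Theorem theorem4p9 (R : comNzRingType) (hR : valuation_ring R) :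
  [<-> maximal_ring R;
       (forall M : lmodType R, singly_projective M -> separable M);
       (forall M : lmodType R, flat M -> content_module M ->
          locally_projective M)].
Proof.
tfae=> [maxR M|sep M flatM contentM|lp].
- exact: singly_projective_separable.
- apply: separable_locally_projective => //; apply: sep.
  exact: flat_content_singly_projective.
- exact: maximal_of_flat_content.
Qed.
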